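(* For any integers $d\ge 1$, $c_1,\ldots,c_d\in\mathbb{N}\setminus\{2\}$ with $c_1\ge 3$, and any complex numbers $z_0,z_1,\ldots,z_d$ with $|z_j|<1$, $j=0,1,\ldots,d$, we have $$\sum_{a_0,a_1,\ldots,a_d\ge 0}\zeta^{\star}(\{2\}^{a_0},c_1,\{2\}^{a_1},\ldots,c_d,\{2\}^{a_d})\,z_0^{2a_0}z_1^{2a_1}\cdots z_d^{2a_d}=-\sum_{k_0\ge k_1\ge\cdots\ge k_d\ge 1}\prod_{i=0}^d\frac{(-1)^{k_i\delta_i}k_i^{\delta_i-1}}{k_i^2-z_i^2}\,S^{\sharp}_{k_{i-1},k_i}(\{1\}^{c_i-3}),$$ where $c_0=1$, $c_{d+1}=0$, $k_{-1}=0$, $\delta_i=\delta(c_i)+\delta(c_{i+1})$ for $0\le i\le d$, and $\delta(c)=2$ if $c=0$, $\delta(c)=1$ if $c=1$, $\delta(c)=0$ if $c\ge 3$.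
   Context: $\mathbb{N}$ is the set of positive integers. For positive integers $s_1,\ldots,s_m$ with $s_1\ge 2$, $\zeta^\star(s_1,\ldots,s_m)=\sum_{k_1\ge\cdots\ge k_m\ge 1}\frac{1}{k_1^{s_1}\cdots k_m^{s_m}}$ (sum over positive integers), and $\zeta^\star(\emptyset)=1$. $\{s\}^a$ denotes the sequence consisting of $a$ copies of $s$. $\Delta(a,b)=0$ if $a=b$ and $\Delta(a,b)=1$ otherwise. For a string $\mathbf r=(r_1,\ldots,r_c)$ of positive integers and integers $k\ge 0$, $m\ge 1$, the multiple sharp sum is $$S^{\sharp}_{k,m}(r_1,\ldots,r_c)=\sum_{k\ge l_1\ge\cdots\ge l_c\ge m}\frac{2^{\Delta(k,l_1)+\Delta(l_1,l_2)+\cdots+\Delta(l_{c-1},l_c)+\Delta(l_c,m)}}{l_1^{r_1}\cdots l_c^{r_c}}\quad\text{if }\mathbf r\ne\emptyset\text{ and }k\ge m,$$ and $S^{\sharp}_{k,m}(\mathbf r)=2^{\Delta(k,m)}$ if $\mathbf r=\emptyset$ or $k<m$. The string $\{1\}^{c_i-3}$ is empty when $c_i\in\{1,3\}$, so that then $S^{\sharp}_{k_{i-1},k_i}(\{1\}^{c_i-3})=2^{\Delta(k_{i-1},k_i)}$. In all sums the indices are integers, and $0^0=1$ in power series. *)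

(* Defs.v *)
From HB Require Import structures.
From mathcomp Require Export all_boot all_order all_algebra.
From mathcomp Require Export classical_sets reals ereal esum.
From mathcomp Require Export complex.

Set Implicit Arguments.
Unset Strict Implicit.
Unset Printing Implicit Defensive.

Import Order.TTheory GRing.Theory Num.Theory.

Local Open Scope ring_scope.

(* Unconditional summation of the family (f i) over the i such that P i: the
   finite partial sums converge to s along the finite index sets ordered by
   inclusion. For complex families this is absolute convergence, and hence
   does not depend on how a multiple sum is arranged. *)
Definition has_sum (F : numFieldType) (I : eqType) (P : pred I) (f : I -> F)
    (s : F) : Prop :=
  forall e : F, 0 < e ->
  exists A : seq I, forall B : seq I, uniq B -> {subset A <= B} ->
    `|\sum_(i <- B | P i) f i - s| < e.

Definition weakly_decreasing_pos (k : seq nat) : bool :=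
  sorted geq k && all (leq 1) k.

(* The terms are nonnegative, so the sum is taken in the extended reals; it is
   finite when the first entry of s is at least 2. For s = [::] the only index
   is the empty tuple, and the value is 1. *)
Definition zeta_star (R : realType) (s : seq nat) : R :=
  fine (\esum_(k in [set k : (size s).-tuple nat | weakly_decreasing_pos k])
          (\prod_(i < size s) ((tnth k i)%:R ^+ nth 0%N s i)^-1)%:E).

Definition Delta (a b : nat) : nat := if a == b then 0 else 1.

(* The values of Delta at consecutive entries of k, l_1, ..., l_c, m are summed
   by [pairmap Delta k (rcons l m)]. Since l_1 <= k, the l_i range over
   'I_k.+1 = {0, ..., k}. *)
Definition multiple_sharp (F : fieldType) (k m : nat) (r : seq nat) : F :=
  if (r == [::]) || (k < m)%N then 2%:R ^+ Delta k m
  else \sum_(l : (size r).-tuple 'I_k.+1 |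
               path geq k (rcons [seq val j | j <- l] m))
         2%:R ^+ sumn (pairmap Delta k (rcons [seq val j | j <- l] m))
         / \prod_(i < size r) (tnth l i)%:R ^+ nth 0%N r i.

(* ({2}^{a_0}, c_1, {2}^{a_1}, ..., c_d, {2}^{a_d}); the entries of c are
   numbered from 0, so c_(i+1) is [tnth c i] and a_(i+1) is
   [tnth a (lift ord0 i)]. *)
Definition zeta_string (d : nat) (c : d.-tuple nat) (a : d.+1.-tuple nat) :
    seq nat :=
  nseq (tnth a ord0) 2 ++
  flatten [seq tnth c i :: nseq (tnth a (lift ord0 i)) 2 | i <- enum 'I_d].

(* c_0, c_1, ..., c_d, c_(d+1) with c_0 = 1 and c_(d+1) = 0 *)
Definition cext (d : nat) (c : d.-tuple nat) (i : nat) : nat :=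
  nth 0%N (1%N :: rcons c 0%N) i.

Definition delta (c : nat) : nat :=
  match c with 0 => 2 | 1 => 1 | _ => 0 end.

Definition deltai (d : nat) (c : d.-tuple nat) (i : nat) : nat :=
  (delta (cext c i) + delta (cext c i.+1))%N.

Definition lhs_term (R : realType) (d : nat) (c : d.-tuple nat)
    (z : 'I_d.+1 -> R[i]) (a : d.+1.-tuple nat) : R[i] :=
  (zeta_star R (zeta_string c a))%:C%C
  * \prod_(j < d.+1) z j ^+ (2 * tnth a j).

(* [nth 0 (0 :: k) i] is k_(i-1), with k_(-1) = 0. The exponent
   delta_i - 1 may be -1, so that power is an integer power. For c_i = 1 the
   truncated difference c_i - 3 is 0, which gives the empty string. *)
Definition rhs_term (R : realType) (d : nat) (c : d.-tuple nat)
    (z : 'I_d.+1 -> R[i]) (k : d.+1.-tuple nat) : R[i] :=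
  \prod_(i < d.+1)
    ((-1) ^+ (tnth k i * deltai c i)
       * (tnth k i)%:R ^ ((deltai c i)%:Z - 1)
       / ((tnth k i)%:R ^+ 2 - z i ^+ 2)
     * multiple_sharp R[i] (nth 0%N (0%N :: k) i) (tnth k i)
         (nseq (cext c i - 3) 1%N)).

(* Main.v *)
Require Import Defs.
From mathcomp Require Import cardinality fsbigop.
From mathcomp Require Import ring lra zify.
Import Order.TTheory GRing.Theory Num.Theory.
Set Implicit Arguments.
Unset Strict Implicit.
Unset Printing Implicit Defensive.
Local Open Scope ring_scope.

(** Cut the star sums off at [n]: let Z_n(s) be zeta-star of s with all
    summation indices at most n. Separating the terms whose largest index is n
    gives Z_n(x, s) = Z_(n-1)(x, s) + n^(-x) Z_n(s), so the truncated
    generating series G_n(z_0; (c_1, z_1), ..., (c_d, z_d)) satisfies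

      (1 - z_0^2/n^2) G_n(z_0; (c_1, z_1), ...)
        = G_(n-1)(z_0; (c_1, z_1), ...) + n^(-c_1) G_n(z_1; (c_2, z_2), ...),

    and this recursion in n and d determines it ([gen_term_sum]).

    The nested sum on the right of the identity has a truncation with the same
    recursion: weight the term of outermost index k_0 by the kernel
    B(n, k_0) = n!^2 / ((n-k_0)! (n+k_0)!). Since
    n^2 B(n-1, k) = (n^2 - k^2) B(n, k), the operator on the left of the
    recursion cancels the denominator k_0^2 - z_0^2 ([closed_form_step]). The
    sum over k_0 is then free of z_0, and it collapses to a multiple of the
    single value B(n, k_1) because

      k B(n, k) + (k+1) B(n, k+1) = n (B(n, k) - B(n, k+1))

    makes it telescope, with or without alternating signs; the weights
    2^Delta in the sharp sums are exactly those that such a telescoping of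
    sums of neighbours produces, and each further layer of a sharp sum costs
    one more factor 1/n ([sum_kernel_inner], [closed_form_cons]). For d = 0
    the identity is the partial fraction expansion of
    prod_(j <= n) (1 - z^2/j^2)^(-1) ([closed_form_nil]).

    It remains to let n tend to infinity, where B(n, k) tends to 1 and Z_n(s)
    to zeta-star of s, by dominated convergence ([tannery]). The right-hand
    side is absolutely summable because the inner sums over k_1, ..., k_d,
    with all terms replaced by their norms, are together at most a constant
    times the square root of k_0 ([chain_le], [full_term_bounded]). That bound, applied to the closed forms at the
    moduli |z_j|, where all terms of the generating series are nonnegative,
    also bounds the left-hand side uniformly in n ([gen_term_bounded]). *)

(** * Limits of sequences and of unconditional sums *)

Definition abs_bounded (F : numFieldType) (I : eqType) (P : pred I) (f : I -> F)
    (M : F) : Prop :=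
  forall B : seq I, uniq B -> \sum_(i <- B | P i) `|f i| <= M.

Definition tends (F : numFieldType) (u : nat -> F) (l : F) : Prop :=
  forall e : F, 0 < e -> exists N, forall n, (N <= n)%N -> `|u n - l| < e.

Section Limits.
Variable F : numFieldType.
Implicit Types (u v : nat -> F) (l : F).

Lemma norm_small_eq0 (x : F) : (forall e, 0 < e -> `|x| < e) -> x = 0.
Proof.
move=> h; apply/eqP; rewrite -normr_le0; apply/ler_addgt0Pr => e e0.
by rewrite add0r ltW // h.
Qed.

Lemma tends_unique u l l' : tends u l -> tends u l' -> l = l'.
Proof.
move=> h h'; apply/eqP; rewrite -subr_eq0; apply/eqP/norm_small_eq0 => e e0.
have e20 : 0 < e / 2 by rewrite divr_gt0.
have [N hN] := h _ e20; have [N' hN'] := h' _ e20.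
have := hN (maxn N N') (leq_maxl _ _); have := hN' (maxn N N') (leq_maxr _ _).
set x := u _ => h1; rewrite distrC => h2.
rewrite (_ : l - l' = (l - x) + (x - l')); last by rewrite addrA subrK.
by rewrite (le_lt_trans (ler_normD _ _)) // [e]splitr ltrD.
Qed.

Lemma tends_ext u v l : u =1 v -> tends u l -> tends v l.
Proof. by move=> uv h e /h[N hN]; exists N => n /hN; rewrite uv. Qed.

Lemma tends_cst l : tends (fun=> l) l.
Proof. by move=> e e0; exists 0%N => n _; rewrite subrr normr0. Qed.

Lemma tendsD u v l m : tends u l -> tends v m -> tends (fun n => u n + v n) (l + m).
Proof.
move=> h h' e e0; have e20 : 0 < e / 2 by rewrite divr_gt0.
have [N hN] := h _ e20; have [N' hN'] := h' _ e20.
exists (maxn N N') => n; rewrite geq_max => /andP[/hN h1 /hN' h2].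
by rewrite opprD addrACA (le_lt_trans (ler_normD _ _)) // [e]splitr ltrD.
Qed.

Lemma tendsZ (a : F) u l : tends u l -> tends (fun n => a * u n) (a * l).
Proof.
move=> h e e0; have a0 : 0 < `|a| + 1 by rewrite ltr_wpDl.
have [N hN] := h (e / (`|a| + 1)) (divr_gt0 e0 a0).
exists N => n /hN hn; rewrite -mulrBr normrM.
apply: (@le_lt_trans _ _ ((`|a| + 1) * `|u n - l|)).
  by rewrite ler_wpM2r // lerDl.
by rewrite mulrC -ltr_pdivlMr.
Qed.

Lemma tends_sum (I : Type) (B : seq I) (P : pred I) (u : nat -> I -> F) (l : I -> F) :
  (forall i, P i -> tends (u ^~ i) (l i)) ->
  tends (fun n => \sum_(i <- B | P i) u n i) (\sum_(i <- B | P i) l i).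
Proof.
move=> h; elim: B => [|i B IH].
  by rewrite big_nil; apply: tends_ext (tends_cst 0) => n; rewrite big_nil.
rewrite big_cons; case: ifPn => [Pi|nPi].
  by apply: tends_ext (tendsD (h i Pi) IH) => n; rewrite big_cons Pi.
by apply: tends_ext IH => n; rewrite big_cons (negPf nPi).
Qed.

Lemma tends_norm u l : tends u l -> tends (fun n => `|u n|) `|l|.
Proof.
move=> h e e0; have [N hN] := h e e0; exists N => n /hN hn.
by apply: le_lt_trans hn; apply: ler_dist_dist.
Qed.

(** The order of [F] is partial, so the limit must first be shown comparable
    with the bound: [M - l] is its own norm, as the limit of the numbers
    [M - u n], which equal their norms. *)
Lemma tends_le u l (M : F) : (forall n, u n <= M) -> tends u l -> l <= M.
Proof.
move=> hu h.
have lr : l - M \is Num.real.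
  have hM : tends (fun n => M - u n) (M - l).
    have := tendsD (tends_cst M) (tendsZ (-1) h); rewrite mulN1r.
    by apply: tends_ext => n; rewrite mulN1r.
  have hn : tends (fun n => M - u n) `|M - l|.
    apply: tends_ext (tends_norm hM) => n.
    by rewrite ger0_norm // subr_ge0.
  by rewrite -opprB rpredN (tends_unique hM hn) normr_real.
rewrite -subr_le0; apply/ler_addgt0Pr => e e0; rewrite add0r.
have [N hN] := h e e0; have := hN N (leqnn _); rewrite distrC => hn.
have lur : l - u N \is Num.real.
  rewrite (_ : l - u N = (l - M) + (M - u N)); last by rewrite addrA subrK.
  by apply: realD => //; apply: ger0_real; rewrite subr_ge0.
apply: (@le_trans _ _ (l - u N)); first by rewrite lerB.
by apply: le_trans (ltW hn); apply: real_ler_norm.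
Qed.

End Limits.

Lemma ler_sum_sub (F : numFieldType) (I : eqType) (P : pred I) (f : I -> F)
    (B C : seq I) : uniq B -> uniq C -> (forall i, P i -> 0 <= f i) ->
  (forall i, i \in B -> P i -> i \in C) ->
  \sum_(i <- B | P i) f i <= \sum_(i <- C | P i) f i.
Proof.
move=> uB uC f0 BC; rewrite [X in _ <= X](bigID (mem B)) /=.
have -> : \sum_(i <- C | P i && (i \in B)) f i = \sum_(i <- B | P i) f i.
  rewrite -big_filter -[RHS]big_filter; apply: perm_big.
  apply: uniq_perm; rewrite ?filter_uniq // => i; rewrite !mem_filter.
  case: (boolP (P i)) => //= Pi; case: (boolP (i \in B)) => //= iB.
  by rewrite BC.
by rewrite lerDl sumr_ge0 // => i /andP[/f0].
Qed.

Section Sums.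
Variable F : numFieldType.
Variables (I : eqType) (P : pred I).
Implicit Types (f g : I -> F) (s t : F) (B : seq I).

Lemma has_sum_unique f s t : has_sum P f s -> has_sum P f t -> s = t.
Proof.
move=> h h'; apply/eqP; rewrite -subr_eq0; apply/eqP/norm_small_eq0 => e e0.
have e20 : 0 < e / 2 by rewrite divr_gt0.
have [A hA] := h _ e20; have [A' hA'] := h' _ e20.
pose B := undup (A ++ A').
have sA : {subset A <= B} by move=> i iA; rewrite mem_undup mem_cat iA.
have sA' : {subset A' <= B} by move=> i iA; rewrite mem_undup mem_cat iA orbT.
have := hA B (undup_uniq _) sA; have := hA' B (undup_uniq _) sA'.
set x := \sum_(i <- B | P i) _ => h1; rewrite distrC => h2.
rewrite (_ : s - t = (s - x) + (x - t)); last by rewrite addrA subrK.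
by rewrite (le_lt_trans (ler_normD _ _)) // [e]splitr ltrD.
Qed.

Lemma has_sum_ext f g s : {in P, f =1 g} -> has_sum P f s -> has_sum P g s.
Proof.
move=> fg h e /h[A hA]; exists A => B uB sB.
by under eq_bigr => i Pi do rewrite -fg //; exact: hA.
Qed.

Lemma has_sumD f g s t :
  has_sum P f s -> has_sum P g t -> has_sum P (fun i => f i + g i) (s + t).
Proof.
move=> h h' e e0; have e20 : 0 < e / 2 by rewrite divr_gt0.
have [A hA] := h _ e20; have [A' hA'] := h' _ e20.
exists (A ++ A') => B uB sB; rewrite big_split /= opprD addrACA.
rewrite (le_lt_trans (ler_normD _ _)) // [e]splitr ltrD //.
  by apply: hA => // i iA; rewrite sB // mem_cat iA.
by apply: hA' => // i iA; rewrite sB // mem_cat iA orbT.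
Qed.

Lemma has_sumZ (a : F) f s : has_sum P f s -> has_sum P (fun i => a * f i) (a * s).
Proof.
move=> h e e0; have a0 : 0 < `|a| + 1 by rewrite ltr_wpDl.
have [A hA] := h (e / (`|a| + 1)) (divr_gt0 e0 a0).
exists A => B uB sB; have hn := hA B uB sB; rewrite -mulr_sumr -mulrBr normrM.
apply: (@le_lt_trans _ _ ((`|a| + 1) * `|\sum_(i <- B | P i) f i - s|)).
  by rewrite ler_wpM2r // lerDl.
by rewrite mulrC -ltr_pdivlMr.
Qed.

Lemma has_sum_finite f (A : seq I) : uniq A ->
  (forall i, P i -> i \notin A -> f i = 0) ->
  has_sum P f (\sum_(i <- A | P i) f i).
Proof.
move=> uA f0 e e0; exists A => B uB sB.
rewrite (bigID (mem A)) /= [X in _ + X - _]big1 ?addr0; last first.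
  by move=> i /andP[Pi iA]; apply: f0.
under eq_bigl do rewrite andbC.
rewrite -big_filter_cond (perm_big A) ?subrr ?normr0 //.
apply: uniq_perm => //; first exact: filter_uniq.
by move=> i; rewrite mem_filter /=; case: (boolP (i \in A)) => //= /sB.
Qed.

(** The bound is [`|s|] because, in a partially ordered field, the hypotheses
    do not give directly that [s] is real. *)
Lemma has_sum_ge f s B : (forall i, P i -> 0 <= f i) -> has_sum P f s ->
  uniq B -> \sum_(i <- B | P i) f i <= `|s|.
Proof.
move=> f0 h uB; apply/ler_addgt0Pr => e e0; have [A hA] := h e e0.
pose C := undup (A ++ B).
have sA : {subset A <= C} by move=> i iA; rewrite mem_undup mem_cat iA.
have := hA C (undup_uniq _) sA; set x := \sum_(i <- C | P i) f i => hx.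
have x0 : 0 <= x by apply: sumr_ge0.
apply: (@le_trans _ _ x).
  by apply: ler_sum_sub => // [|i iB _]; rewrite ?undup_uniq // mem_undup mem_cat iB orbT.
rewrite -(ger0_norm x0) -[x](subrK s) addrC (le_trans (ler_normD _ _)) //.
by rewrite lerD2l ltW.
Qed.

Lemma abs_boundedD f g M N : abs_bounded P f M -> abs_bounded P g N ->
  abs_bounded P (fun i => f i + g i) (M + N).
Proof.
move=> fM gN B uB; apply: le_trans (lerD (fM B uB) (gN B uB)).
by rewrite -big_split; apply: ler_sum => i _; apply: ler_normD.
Qed.

Lemma abs_boundedZ (a : F) f M : abs_bounded P f M ->
  abs_bounded P (fun i => a * f i) (`|a| * M).
Proof.
move=> fM B uB; under eq_bigr do rewrite normrM.
by rewrite -mulr_sumr ler_wpM2l // fM.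
Qed.

Lemma abs_bounded_finite f (A : seq I) : uniq A ->
  (forall i, P i -> i \notin A -> f i = 0) ->
  abs_bounded P f (\sum_(i <- A | P i) `|f i|).
Proof.
move=> uA f0 B uB; rewrite (bigID (mem A)) /= [X in _ + X]big1 ?addr0.
  rewrite -big_filter -[leRHS]big_filter; apply: ler_sum_sub => //.
  - exact: filter_uniq.
  - exact: filter_uniq.
  - by move=> i; rewrite !mem_filter => /andP[/andP[-> ->]].
by move=> i /andP[Pi iA]; rewrite f0 // normr0.
Qed.

End Sums.

(** The index sets of different depths, and tuples and sequences, are related
    by injections [h] with an explicit partial inverse [h']. *)

Section Transport.
Variables (F : numFieldType) (I J : eqType) (P : pred I) (Q : pred J).
Variables (h : J -> I) (h' : I -> option J).
Hypothesis hK : pcancel h h'.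
Hypothesis h'K : ocancel h' h.
Hypothesis PQ : forall j, P (h j) = Q j.
Implicit Types (f : I -> F) (g : J -> F) (s M : F).

Lemma sum_oapp g (B : seq I) :
  \sum_(i <- B | P i) oapp g 0 (h' i) = \sum_(j <- pmap h' B | Q j) g j.
Proof.
elim: B => [|i B IH]; first by rewrite !big_nil.
rewrite big_cons /= IH; case E: (h' i) => [j|] /=; last first.
  by case: ifP; rewrite ?add0r.
rewrite big_cons; have := h'K i; rewrite E /= => ij.
by rewrite -{1}ij PQ.
Qed.

Lemma has_sum_push g s : has_sum Q g s -> has_sum P (fun i => oapp g 0 (h' i)) s.
Proof.
move=> H e e0; have [A hA] := H e e0; exists (map h A) => B uB sB.
rewrite sum_oapp; apply: hA; first exact: pmap_uniq.
by move=> j jA; rewrite (can2_mem_pmap h'K hK) sB // map_f.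
Qed.

Lemma abs_bounded_push g M : abs_bounded Q g M ->
  abs_bounded P (fun i => oapp g 0 (h' i)) M.
Proof.
move=> gM B uB; apply: le_trans (gM _ (pmap_uniq h'K uB)).
rewrite -sum_oapp; apply: ler_sum => i _.
by case: (h' i) => [j|] //=; rewrite normr0.
Qed.

(** A finite set for [J] need not cover the indices of [A] outside the range of
    [h]; these are added back and contribute nothing, since they do not satisfy
    [P]. *)
Lemma has_sum_pull f s : (forall i, P i -> h' i != None) ->
  has_sum P f s -> has_sum Q (f \o h) s.
Proof.
move=> P0 H e e0; have [A hA] := H e e0.
exists (pmap h' A) => B uB sB.
pose N := [seq i <- undup A | h' i == None].
have uC : uniq (map h B ++ N).
  rewrite cat_uniq (map_inj_uniq (pcan_inj hK)) uB filter_uniq ?undup_uniq //.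
  rewrite andbT; apply/hasPn => i; rewrite mem_filter => /andP[/eqP h'i _].
  by apply/mapP => -[j _ ij]; move: h'i; rewrite ij hK.
have sC : {subset A <= map h B ++ N}.
  move=> i iA; rewrite mem_cat mem_filter mem_undup iA andbT.
  case E: (h' i) => [j|]; rewrite ?eqxx ?orbT // orbF.
  have ij : h j = i by have := h'K i; rewrite E.
  by rewrite -ij map_f // sB // mem_pmap -E map_f.
have := hA _ uC sC; rewrite big_cat big_map [X in _ + X - _]big1_seq /=.
  by rewrite addr0; under eq_bigl do rewrite PQ.
move=> i /andP[/P0 h'i]; rewrite mem_filter => /andP[h'i0 _].
by rewrite h'i0 in h'i.
Qed.

End Transport.

(** * Existence of sums and dominated convergence *)

Section Tails.
Variables (F : numFieldType) (I : eqType) (P : pred I).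
Implicit Types (f g : I -> F) (s t e : F) (A B : seq I).

Lemma has_sum_tail f s : has_sum P (fun i => `|f i|) s ->
  forall e, 0 < e -> exists2 A, uniq A &
    forall B, uniq (A ++ B) -> \sum_(i <- B | P i) `|f i| <= e.
Proof.
move=> h e e0; have e20 : 0 < e / 2 by rewrite divr_gt0.
have [A' hA] := h _ e20; exists (undup A'); first exact: undup_uniq.
move=> B uAB; have := hA _ uAB; have := hA _ (undup_uniq A').
rewrite big_cat /=; set x := bigop _ _ _; set y := bigop _ _ _ => h1 h2.
have {}h1 : `|s - x| < e / 2 by rewrite distrC h1 // => i; rewrite mem_undup.
have {}h2 : `|x + y - s| < e / 2.
  by apply: h2 => i iA; rewrite mem_cat mem_undup iA.
have y0 : 0 <= y by apply: sumr_ge0.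
rewrite -(ger0_norm y0) (_ : y = (x + y - s) + (s - x)); last by ring.
by rewrite (le_trans (ler_normD _ _)) // [e]splitr ltW // ltrD.
Qed.

(** A bound on the partial sums that avoid [A] passes to the remainder,
    because every finite index set can be enlarged to one containing [A]. *)
Lemma has_sum_tail_le f s e A : has_sum P f s -> uniq A ->
  (forall B, uniq (A ++ B) -> \sum_(i <- B | P i) `|f i| <= e) ->
  `|s - \sum_(i <- A | P i) f i| <= e.
Proof.
move=> h uA hA; apply/ler_addgt0Pr => e' e'0.
have [A' hA'] := h _ e'0.
pose B := [seq i <- undup A' | i \notin A].
have uAB : uniq (A ++ B).
  rewrite cat_uniq uA filter_uniq ?undup_uniq // andbT.
  by apply/hasPn => i; rewrite mem_filter => /andP[].
have sAB : {subset A' <= A ++ B}.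
  by move=> i iA; rewrite mem_cat mem_filter mem_undup iA andbT orbN.
have := hA' _ uAB sAB; rewrite big_cat /=.
set x := bigop _ _ _; set y := bigop _ _ _ => h1.
rewrite (_ : s - x = y - (x + y - s)); last by ring.
rewrite (le_trans (ler_normB _ _)) // lerD ?(ltW h1) //.
exact: le_trans (ler_norm_sum _ _ _) (hA _ uAB).
Qed.

End Tails.

Section Existence.
Variables (R : realType) (I : eqType) (P : pred I).
Implicit Types (B : seq I).

Lemma has_sum_nonneg (f : I -> R) (M : R) : (forall i, P i -> 0 <= f i) ->
  (forall B, uniq B -> \sum_(i <- B | P i) f i <= M) -> exists s, has_sum P f s.
Proof.
move=> f0 hM.
pose E : set R := [set x | exists2 B, uniq B & x = \sum_(i <- B | P i) f i]%classic.
have hE : has_sup E.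
  split; first by exists 0, [::]; rewrite ?big_nil.
  by exists M => x [B uB ->]; apply: hM.
exists (sup E) => e e0; have [x [A uA ->] hx] := sup_adherent e0 hE.
exists A => B uB sB.
have le1 : \sum_(i <- B | P i) f i <= sup E.
  by apply: ub_le_sup; [exact: (proj2 hE) | exists B].
have le2 : \sum_(i <- A | P i) f i <= \sum_(i <- B | P i) f i.
  by apply: ler_sum_sub => // i /sB.
rewrite distrC ger0_norm ?subr_ge0 // ltrBlDr -ltrBlDl.
exact: lt_le_trans hx le2.
Qed.

(** [f] is the difference of the nonnegative families [f + `|f|] and [`|f|]. *)
Lemma has_sum_real (f : I -> R) (M : R) : abs_bounded P f M ->
  exists s, has_sum P f s.
Proof.
move=> hM.
have [t ht] := has_sum_nonneg (fun i _ => normr_ge0 (f i)) hM.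
have [||s hs] := @has_sum_nonneg (fun i => f i + `|f i|) (M + M).
- by move=> i _; rewrite -lerBlDl sub0r -normrN ler_norm.
- move=> B uB; rewrite big_split lerD ?hM //.
  by apply: le_trans (hM B uB); apply: ler_sum => i _; apply: ler_norm.
exists (s + -1 * t); apply: has_sum_ext (has_sumD hs (has_sumZ (-1) ht)).
by move=> i _ /=; rewrite mulN1r addrK.
Qed.

Lemma normc_ge_Im (x : R[i]) : (`|complex.Im x|%:C)%C <= `|x|.
Proof.
by rewrite normc_def lecR -sqrtr_sqr ler_wsqrtr // lerDr sqr_ge0.
Qed.

Lemma has_sum_complex (f : I -> R[i]) (M : R[i]) : abs_bounded P f M ->
  exists s, has_sum P f s.
Proof.
move=> hM.
have re_sum (g : I -> R[i]) B :
    complex.Re (\sum_(i <- B | P i) g i) = \sum_(i <- B | P i) complex.Re (g i).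
  by apply: (big_morph (@complex.Re R)) => // -[a b] [c d].
have im_sum (g : I -> R[i]) B :
    complex.Im (\sum_(i <- B | P i) g i) = \sum_(i <- B | P i) complex.Im (g i).
  by apply: (big_morph (@complex.Im R)) => // -[a b] [c d].
have hRe : abs_bounded P (fun i => complex.Re (f i)) (complex.Re M).
  move=> B uB; have := hM B uB; rewrite lecE => /andP[_]; apply: le_trans.
  rewrite re_sum; apply: ler_sum => i _.
  by have := normc_ge_Re (f i); rewrite lecE => /andP[].
have hIm : abs_bounded P (fun i => complex.Im (f i)) (complex.Re M).
  move=> B uB; have := hM B uB; rewrite lecE => /andP[_]; apply: le_trans.
  rewrite re_sum; apply: ler_sum => i _.
  by have := normc_ge_Im (f i); rewrite lecE => /andP[].
have [a ha] := has_sum_real hRe; have [b hb] := has_sum_real hIm.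
exists (a +i* b)%C => e e0.
have /andP[/eqP ie re] : (complex.Im e == 0) && (0 < complex.Re e).
  by move: e0; rewrite ltcE eq_sym.
have ee : e = (complex.Re e)%:C%C by case: e ie {e0 re} => x y /= ->.
have e20 : 0 < complex.Re e / 2 by rewrite divr_gt0.
have [A hA] := ha _ e20; have [A' hA'] := hb _ e20.
exists (A ++ A') => B uB sB.
have sA : {subset A <= B} by move=> i iA; rewrite sB // mem_cat iA.
have sA' : {subset A' <= B} by move=> i iA; rewrite sB // mem_cat iA orbT.
have := hA B uB sA; have := hA' B uB sA'.
rewrite -re_sum -im_sum; set x := bigop _ _ _ => h1 h2.
rewrite ee [complex.Re e]splitr rmorphD /=.
have -> : x - (a +i* b)%C
    = (complex.Re x - a)%:C%C + 'i%C * (complex.Im x - b)%:C%C.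
  by case: x {h1 h2} => u v; rewrite [LHS]complexE.
apply: le_lt_trans (ler_normD _ _) _; rewrite normrM.
have -> : `|'i%C| = 1 :> R[i] by rewrite normc_def /= expr0n /= add0r expr1n sqrtr1.
rewrite mul1r; apply: ltrD.
  by rewrite normc_def /= expr0n /= addr0 sqrtr_sqr ltcR.
by rewrite normc_def /= expr0n /= addr0 sqrtr_sqr ltcR.
Qed.

(** Dominated convergence: outside one finite set [A], chosen for the limit
    [f], the sums of all the [f_ n] are small at once, and on [A] only finitely
    many limits are taken. *)
Lemma tannery (f_ : nat -> I -> R[i]) (f : I -> R[i]) (s_ : nat -> R[i]) (M : R[i]) :
  (forall n, abs_bounded P (f_ n) M) ->
  (forall n i, P i -> `|f_ n i| <= `|f i|) ->
  (forall i, P i -> tends (f_^~ i) (f i)) ->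
  (forall n, has_sum P (f_ n) (s_ n)) ->
  exists2 S, has_sum P f S & tends s_ S.
Proof.
move=> hM hdom hf hs.
have fM : abs_bounded P f M.
  move=> B uB; apply: (tends_le (fun n => hM n B uB)).
  by apply: tends_sum => i Pi; apply: tends_norm; apply: hf.
have [S hS] := has_sum_complex fM; exists S => //.
have [T hT] : exists T, has_sum P (fun i => `|f i|) T.
  apply: (@has_sum_complex _ M) => B uB.
  by under eq_bigr do rewrite normr_id; apply: fM.
move=> e e0; have e3 : 0 < e / 3 by rewrite divr_gt0.
have [A uA hA] := has_sum_tail hT e3.
have hSA := has_sum_tail_le hS uA hA.
have [N hN] := tends_sum A hf e3.
exists N => n /hN hn.
have hnA : `|s_ n - \sum_(i <- A | P i) f_ n i| <= e / 3.
  apply: has_sum_tail_le (hs n) uA _ => B /hA; apply: le_trans.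
  by apply: ler_sum => i; apply: hdom.
move: hSA hnA hn; set x := bigop _ _ _; set y := bigop _ _ _ => h1 h2 h3.
rewrite (_ : s_ n - S = (s_ n - y) + (y - x) - (S - x)); last by ring.
rewrite (_ : e = e / 3 + e / 3 + e / 3); last by field.
apply: le_lt_trans (ler_normB _ _) _; apply: ltr_leD => //.
by apply: le_lt_trans (ler_normD _ _) _; apply: ler_ltD.
Qed.

End Existence.

(** * Families defined by a geometric recursion *)

Lemma one_sub_neq0 (F : numFieldType) (q : F) : `|q| < 1 -> 1 - q != 0.
Proof.
by move=> q1; apply: contraTneq q1 => /subr0_eq <-; rewrite normr1 ltxx.
Qed.

Section Geometric.
Variables (R : realType) (I : eqType) (P : pred I).
Variables (h : I -> I) (h' : I -> option I) (rank : I -> nat).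
Hypothesis hK : pcancel h h'.
Hypothesis h'K : ocancel h' h.
Hypothesis Ph : forall i, P (h i) = P i.
Hypothesis rank_h : forall i, P i -> (rank i < rank (h i))%N.

(** If [f] is [g] plus [q] times a shifted copy of itself, its sum [t] satisfies
    [t = s + q * t]. To have a sum at all, [f] must first be absolutely
    bounded: applying the recursion to a finite set [B] replaces [B] by a set of
    smaller ranks, at the cost of a factor [`|q|]. *)
Lemma has_sum_geometric (f g : I -> R[i]) (q s M : R[i]) :
  `|q| < 1 ->
  (forall i, P i -> f i = g i + q * oapp f 0 (h' i)) ->
  abs_bounded P g M -> has_sum P g s ->
  abs_bounded P f (M / (1 - `|q|)) /\ has_sum P f (s / (1 - q)).
Proof.
move=> q1 fE gM gs.
have M0 : 0 <= M by have := gM [::] isT; rewrite big_nil.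
have q0 : 0 < 1 - `|q| by rewrite subr_gt0.
have fb N B : uniq B -> (forall i, i \in B -> P i -> rank i < N)%N ->
    \sum_(i <- B | P i) `|f i| <= M / (1 - `|q|).
  elim: N B => [|N IH] B uB rB.
    rewrite big1_seq; first by rewrite divr_ge0 // ltW.
    by move=> i /andP[Pi iB]; have := rB i iB Pi.
  have -> : M / (1 - `|q|) = M + `|q| * (M / (1 - `|q|)).
    by field; rewrite gt_eqF.
  apply: (@le_trans _ _ (\sum_(i <- B | P i) `|g i|
      + `|q| * \sum_(i <- B | P i) oapp (fun j => `|f j|) 0 (h' i))).
    rewrite mulr_sumr -big_split /=; apply: ler_sum => i Pi.
    rewrite fE // (le_trans (ler_normD _ _)) // lerD2l normrM.
    by case: (h' i) => [j|] //=; rewrite normr0.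
  rewrite lerD ?gM // ler_wpM2l // (sum_oapp h'K Ph); apply: IH.
    exact: (pmap_uniq h'K).
  move=> j; rewrite (can2_mem_pmap h'K hK) => hjB Pj.
  have := rB _ hjB; rewrite Ph ltnS => /(_ Pj); exact: leq_trans (rank_h Pj).
have fM : abs_bounded P f (M / (1 - `|q|)).
  move=> B uB; apply: (fb (\max_(i <- B) rank i).+1) => // i iB _.
  by rewrite ltnS leq_bigmax_seq.
split=> //; have [t ft] := has_sum_complex fM.
have : has_sum P f (s + q * t).
  apply: has_sum_ext (has_sumD gs (has_sumZ q (has_sum_push hK h'K Ph ft))).
  by move=> i Pi /=; rewrite fE.
move=> /(has_sum_unique ft) tE.
have q1' := one_sub_neq0 q1.
suff -> : s / (1 - q) = t by [].
by apply: (mulIf q1'); rewrite divfK // mulrBr mulr1 {1}tE [t * q]mulrC addrK.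
Qed.

End Geometric.

(** * The kernel and its telescoping sums *)

Section Kernel.
Variable F : numFieldType.

(** This is n!^2 / ((n-k)! (n+k)!), in a form that vanishes for [n < k] and whose
    dependence on [k] is one more factor. *)
Definition kernel (n k : nat) : F := \prod_(j < k) ((n%:R - j%:R) / (n + j.+1)%:R).

Lemma kernelS n k :
  kernel n k.+1 = kernel n k * ((n%:R - k%:R) / (n + k.+1)%:R).
Proof. by rewrite /kernel big_ord_recr. Qed.

Lemma kernel_gt n k : (n < k)%N -> kernel n k = 0.
Proof.
move=> nk; rewrite /kernel (bigD1 (Ordinal nk)) //=.
by rewrite subrr mul0r mul0r.
Qed.

Lemma natr_neq0 n : (n.+1%:R : F) != 0.
Proof. by rewrite pnatr_eq0. Qed.

Lemma kernel_row n k :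
  n.+1%:R ^+ 2 * kernel n k = kernel n.+1 k * (n.+1%:R ^+ 2 - k%:R ^+ 2).
Proof.
elim: k => [|k IH]; first by rewrite /kernel !big_ord0 expr0n subr0 mul1r mulr1.
rewrite !kernelS mulrA IH.
have h1 := natr_neq0 (n + k); have h2 := natr_neq0 (n + k).+1.
move: h1 h2; rewrite !addnS !addSn => h1 h2.
rewrite -![in RHS]natr1 -!natr1 !natrD in h1 h2 *.
by field; rewrite -!natrD in h1 h2 *; rewrite ?h1 ?h2.
Qed.

Lemma kernel_pair n k :
  k%:R * kernel n k + k.+1%:R * kernel n k.+1
  = n%:R * (kernel n k - kernel n k.+1).
Proof.
rewrite kernelS addnS.
have h1 := natr_neq0 (n + k); rewrite -natr1 natrD -[k.+1%:R]natr1 in h1 *.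
by field.
Qed.

(** The weight [2 ^+ Delta k m] is 1 at the first index and 2 afterwards, so the
    weighted sum of [a] is the sum of [a k + a k.+1], and this telescopes. *)
Lemma delta_telescope (a b : nat -> F) n m : a n.+1 = 0 -> b n.+1 = 0 ->
  (forall k, a k + a k.+1 = b k - b k.+1) -> (m <= n.+1)%N ->
  \sum_(m <= k < n.+1) 2 ^+ Delta k m * a k = b m.
Proof.
move=> a0 b0 ab; rewrite leq_eqVlt => /orP[/eqP ->|mn].
  by rewrite big_geq // b0.
rewrite big_ltn // {1}/Delta eqxx mul1r.
pose f k := - (a k + b k).
rewrite (@telescope_sumr_eq _ _ _ f) // => [|k /andP[mk _]].
  have := ab m; rewrite /f a0 b0 => abm.
  rewrite (_ : b m = a m + a m.+1 + b m.+1); last by rewrite abm subrK.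
  by ring.
have abk : a k.+1 + b k.+1 = b k - a k.
  by rewrite -[b k](subrK (b k.+1)) -ab; ring.
by rewrite /f abk /Delta gtn_eqF // expr1; ring.
Qed.

Lemma sum_kernel_nat n m : (m <= n)%N ->
  \sum_(m <= k < n.+1) 2 ^+ Delta k m * (k%:R * kernel n k) = n%:R * kernel n m.
Proof.
move=> mn.
apply: (@delta_telescope (fun k => k%:R * kernel n k) (fun k => n%:R * kernel n k)).
- by rewrite kernel_gt ?mulr0.
- by rewrite kernel_gt ?mulr0.
- by move=> k; rewrite kernel_pair mulrBr.
- exact: leqW.
Qed.

Lemma sum_kernel_sign n m : (0 < n)%N -> (m <= n)%N ->
  \sum_(m <= k < n.+1) 2 ^+ Delta k m * ((-1) ^+ k * kernel n k)
  = m%:R / n%:R * ((-1) ^+ m * kernel n m).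
Proof.
case: n => // n _ mn; have n0 := natr_neq0 n.
apply: (@delta_telescope (fun k => (-1) ^+ k * kernel n.+1 k)
  (fun k => k%:R / n.+1%:R * ((-1) ^+ k * kernel n.+1 k))).
- by rewrite kernel_gt ?mulr0.
- by rewrite kernel_gt ?mulr0.
- move=> k; apply: (mulfI n0).
  rewrite (_ : n.+1%:R * ((-1) ^+ k * kernel n.+1 k + (-1) ^+ k.+1 * kernel n.+1 k.+1)
     = (-1) ^+ k * (n.+1%:R * (kernel n.+1 k - kernel n.+1 k.+1))); last by rewrite exprS; ring.
  by rewrite -kernel_pair exprS; field.
- exact: leqW.
Qed.

(** The summand is a difference only after multiplication by [2 n - 2], which
    excludes [n = 1]. The primitive vanishes at both ends, at [k = 1] because of
    its factor [k - 1] and at [k = n + 1] because of the kernel. *)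
Lemma sum_kernel_sqr n : (1 < n)%N ->
  \sum_(1 <= k < n.+1) kernel n k * ((-1) ^+ k * k%:R ^+ 2) = 0.
Proof.
move=> n1.
pose T k : F := - ((-1) ^+ k * ((n + k)%:R * (k%:R * (k%:R - 1))) * kernel n k).
have n2 : (2 * n%:R - 2 : F) != 0.
  by rewrite -natrM -natrB ?pnatr_eq0 ?subn_eq0 -?ltnNge //; lia.
apply: (mulfI n2); rewrite mulr0 mulr_sumr (@telescope_sumr_eq _ _ _ T) //.
  by rewrite /T kernel_gt // mulr0 subrr !mulr0 mul0r subrr.
move=> k _; rewrite /T kernelS addnS.
have h1 := natr_neq0 (n + k); rewrite -natr1 natrD -[k.+1%:R]natr1 in h1 *.
by rewrite [(-1) ^+ k.+1]exprS; field.
Qed.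

Lemma exchange_triangle (G : nat -> nat -> F) m n :
  \sum_(m <= k < n) \sum_(m <= l < k.+1) G k l
  = \sum_(m <= l < n) \sum_(l <= k < n) G k l.
Proof.
transitivity (\sum_(m <= k < n) \sum_(m <= l < n | (l <= k)%N) G k l).
  apply: eq_big_nat => k /andP[mk kn].
  by rewrite (big_nat_widen _ _ n).
rewrite (exchange_big_dep_nat xpredT) //=; apply: eq_big_nat => l /andP[ml ln].
by rewrite [RHS](big_nat_widenl _ m).
Qed.

(** The multiple sharp sum with its outermost index summed first. Only
    nonempty [r] with [k < m] would distinguish it from [multiple_sharp]. *)
Fixpoint sharp (r : seq nat) (k m : nat) : F :=
  if r is x :: r' then
    \sum_(m <= l < k.+1) 2 ^+ Delta k l / l%:R ^+ x * sharp r' l m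
  else 2 ^+ Delta k m.

(** Summing over the outermost index [k] of the pair ([k], first index [l] of
    the sharp sum) turns the weight [1 / l] into [1 / n] and leaves a sum of the
    same form with one entry fewer. *)
Lemma sum_kernel_sharp n m r : (0 < m <= n)%N ->
  \sum_(m <= k < n.+1) (-1) ^+ k * kernel n k * sharp (nseq r 1%N) k m
  = m%:R / n%:R ^+ r.+1 * ((-1) ^+ m * kernel n m).
Proof.
move=> /andP[m0 mn]; have n0 : (0 < n)%N by apply: leq_trans mn.
have nn0 : n%:R != 0 :> F by rewrite pnatr_eq0 -lt0n.
elim: r => [|r IH] /=.
  by rewrite expr1 -sum_kernel_sign //; apply: eq_bigr => k _; rewrite mulrC.
under eq_bigr do rewrite mulr_sumr.
rewrite exchange_triangle.
rewrite exprS -[RHS]mulr1 (_ : _ * 1 = n%:R^-1 *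
   (m%:R / n%:R ^+ r.+1 * ((-1) ^+ m * kernel n m))); last first.
  by rewrite mulr1 invfM; ring.
rewrite -IH mulr_sumr; apply: eq_big_nat => l /andP[ml ln].
have l0 : l%:R != 0 :> F by rewrite pnatr_eq0 -lt0n (leq_trans m0).
rewrite (_ : \sum_(l <= k < n.+1) _ =
   (\sum_(l <= k < n.+1) 2 ^+ Delta k l * ((-1) ^+ k * kernel n k))
   * (l%:R^-1 * sharp (nseq r 1%N) l m)); last first.
  by rewrite mulr_suml; apply: eq_bigr => k _; rewrite expr1; ring.
by rewrite sum_kernel_sign //; field; rewrite nn0.
Qed.

End Kernel.

(** * The nested sums and their recursion *)

Section ClosedForm.
Variable F : numFieldType.
Implicit Types (z : F) (ps : seq (nat * F)).

(** The data (c_1, z_1), ..., (c_d, z_d) are kept as a list of pairs, from which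
    recursions remove the head; the next entry after the last one is
    c_(d+1) = 0. *)
Definition next_entry ps : nat := if ps is (c, _) :: _ then c else 0.

(** The factor of index i, with c = c_i, c' = c_(i+1), k' = k_(i-1), k = k_i. *)
Definition factor (c c' : nat) z (k' k : nat) : F :=
  (-1) ^+ (k * (delta c + delta c')) * k%:R ^ ((delta c + delta c')%N%:Z - 1)
    / (k%:R ^+ 2 - z ^+ 2) * sharp F (nseq (c - 3) 1%N) k' k.

Fixpoint tail ps (k' : nat) : F :=
  if ps is (c, z) :: ps' then
    \sum_(1 <= k < k'.+1) factor c (next_entry ps') z k' k * tail ps' k
  else 1.

Definition head_term z ps (k : nat) : F :=
  factor 1 (next_entry ps) z 0 k * tail ps k.

Definition closed_form z ps (n : nat) : F :=
  - \sum_(1 <= k < n.+1) kernel F n k * head_term z ps k.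

(** [delta c + delta c'] splits the sign and the power of [k] into a part that
    depends on [c] and one that depends on [c']. *)
Lemma factorE c c' z k' k : (0 < k)%N ->
  factor c c' z k' k = ((-1) ^+ k * k%:R) ^+ delta c * ((-1) ^+ k * k%:R) ^+ delta c'
    / k%:R / (k%:R ^+ 2 - z ^+ 2) * sharp F (nseq (c - 3) 1%N) k' k.
Proof.
move=> k0; have kn0 : k%:R != 0 :> F by rewrite pnatr_eq0 -lt0n.
rewrite /factor -exprD exprMn exprM; congr (_ / _ * _).
  by rewrite -!mulrA; congr (_ * _); rewrite expfzDr // exprN1.
Qed.

Lemma headE z ps k : (0 < k)%N ->
  head_term z ps k = 2 * (-1) ^+ k * ((-1) ^+ k * k%:R) ^+ delta (next_entry ps)
    / (k%:R ^+ 2 - z ^+ 2) * tail ps k.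
Proof.
move=> k0; have kn0 : k%:R != 0 :> F by rewrite pnatr_eq0 -lt0n.
rewrite /head_term factorE // /= /Delta ltn_eqF // !expr1.
congr (_ * _); set w := _ ^+ delta _; set v := (_ - _)^-1.
by field.
Qed.

(** By [kernel_row] the operator multiplies the term of index [k] by
    [(k ^ 2 - z ^ 2) / (n + 1) ^ 2], which removes its denominator. *)
Lemma closed_form_step z ps n : (forall k, (0 < k)%N -> k%:R ^+ 2 - z ^+ 2 != 0) ->
  (1 - z ^+ 2 / n.+1%:R ^+ 2) * closed_form z ps n.+1 - closed_form z ps n
  = - (2 / n.+1%:R ^+ 2 * \sum_(1 <= k < n.+2) kernel F n.+1 k *
       ((-1) ^+ k * ((-1) ^+ k * k%:R) ^+ delta (next_entry ps) * tail ps k)).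
Proof.
move=> hz; have n0 := natr_neq0 F n.
have -> : closed_form z ps n
    = - \sum_(1 <= k < n.+2) kernel F n k * head_term z ps k.
  by rewrite /closed_form [in RHS]big_nat_recr //= kernel_gt // mul0r addr0.
rewrite /closed_form mulrN opprK -[RHS]opprK opprK -[LHS]opprK; congr (- _).
rewrite opprD opprK !mulr_sumr -sumrN -big_split /=; apply: eq_big_nat => k /andP[k0 _].
have {}hz := hz k k0.
have kE : kernel F n k
    = kernel F n.+1 k * (n.+1%:R ^+ 2 - k%:R ^+ 2) / n.+1%:R ^+ 2.
  by rewrite -kernel_row; field.
rewrite kE headE //; set w := _ ^+ delta _; set t := tail _ _.
by field; rewrite nat1r n0 hz.
Qed.

Definition admissible ps := all (fun p => (0 < p.1)%N && (p.1 != 2%N)) ps.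

(** The reason for the values of [delta]: they supply the power of [k] and the
    sign for which the sum telescopes, namely [k] without sign if [c = 1] and
    the sign alone if [3 <= c]. *)
Lemma sum_kernel_inner c n m : (0 < c)%N -> c <> 2%N -> (0 < m <= n)%N ->
  \sum_(m <= k < n.+1) kernel F n k * ((-1) ^+ k * ((-1) ^+ k * k%:R) ^+ delta c
     * sharp F (nseq (c - 3) 1%N) k m) * (((-1) ^+ m * m%:R) ^+ delta c / m%:R)
  = n%:R ^+ 2 / n%:R ^+ c * ((-1) ^+ m * kernel F n m).
Proof.
move=> c0 c2 /andP[m0 mn]; have n0 : (0 < n)%N by apply: leq_trans mn.
have nn0 : n%:R != 0 :> F by rewrite pnatr_eq0 -lt0n.
have mn0 : m%:R != 0 :> F by rewrite pnatr_eq0 -lt0n.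
case: c c0 c2 => [//|[_ _|[//|r] _ _]].
  transitivity (n%:R * kernel F n m * (-1) ^+ m); last by field.
  rewrite -sum_kernel_nat // mulr_suml; apply: eq_bigr => k _.
  have sq : (-1) ^+ k * (-1) ^+ k = 1 :> F by rewrite -exprMn mulrNN mulr1 expr1n.
  rewrite /= !expr1 mulfK // [(-1) ^+ k * _]mulrA sq mul1r.
  by ring.
rewrite /= !subSS subn0 !expr0 mul1r -mulr_suml.
rewrite (_ : \sum_(m <= k < n.+1) _ =
    \sum_(m <= k < n.+1) (-1) ^+ k * kernel F n k * sharp F (nseq r 1%N) k m).
  rewrite sum_kernel_sharp ?m0 // -[r.+3]/(2 + r.+1)%N exprD.
  by field; rewrite expf_neq0 ?nn0 ?mn0.
by apply: eq_bigr => k _; ring.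
Qed.

Lemma closed_form_cons z0 c z ps n :
  (forall k, (0 < k)%N -> k%:R ^+ 2 - z0 ^+ 2 != 0) ->
  (forall k, (0 < k)%N -> k%:R ^+ 2 - z ^+ 2 != 0) ->
  (0 < c)%N -> c <> 2%N ->
  (1 - z0 ^+ 2 / n.+1%:R ^+ 2) * closed_form z0 ((c, z) :: ps) n.+1
  = closed_form z0 ((c, z) :: ps) n + n.+1%:R ^- c * closed_form z ps n.+1.
Proof.
move=> hz0 hz c0 c2; have n0 := natr_neq0 F n.
apply/eqP; rewrite [eqbRHS]addrC -subr_eq closed_form_step //=; apply/eqP.
rewrite /closed_form mulrN; congr (- _).
under eq_bigr do rewrite !mulr_sumr.
rewrite exchange_triangle !mulr_sumr; apply: eq_big_nat => m /andP[m0 mn].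
have {}hz := hz m m0.
have mn0 : m%:R != 0 :> F by rewrite pnatr_eq0 -lt0n.
have := @sum_kernel_inner c n.+1 m c0 c2; rewrite m0 -ltnS mn => /(_ isT) inner.
pose e : F := ((-1) ^+ m * m%:R) ^+ delta (next_entry ps).
transitivity (2 / n.+1%:R ^+ 2 * (n.+1%:R ^+ 2 / n.+1%:R ^+ c
    * ((-1) ^+ m * kernel F n.+1 m)) * (e / (m%:R ^+ 2 - z ^+ 2) * tail ps m)).
  rewrite -inner -[RHS]mulrA mulr_suml; congr (_ * _).
  apply: eq_bigr => k _; rewrite factorE // -/e.
  set w := _ ^+ delta c; set w' := _ ^+ delta c; set v := (_ - _)^-1.
  by ring.
rewrite headE // -/e; set w := _ ^+ c; set t := tail _ _.
have w0 : w != 0 by rewrite expf_neq0.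
by field; rewrite nat1r n0 hz w0.
Qed.

Lemma closed_form_nil z n : (forall k, (0 < k)%N -> k%:R ^+ 2 - z ^+ 2 != 0) ->
  (1 - z ^+ 2 / n.+1%:R ^+ 2) * closed_form z [::] n.+1
  = if n is 0 then 1 else closed_form z [::] n.
Proof.
move=> hz; have := closed_form_step [::] n hz.
rewrite /= (_ : \sum_(1 <= k < n.+2) _ = \sum_(1 <= k < n.+2)
    kernel F n.+1 k * ((-1) ^+ k * k%:R ^+ 2)); last first.
  apply: eq_bigr => k _; rewrite exprMn -exprM mulnC exprM sqrrN expr1n.
  by rewrite expr1n mul1r mulr1.
case: n => [|n].
  rewrite [closed_form _ _ 0]/closed_form big_geq // oppr0 subr0 => ->.
  rewrite big_nat1 kernelS /kernel big_ord0 subr0 mul1r expr1 !expr1n.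
  by field.
by rewrite sum_kernel_sqr // mulr0 oppr0 => /eqP; rewrite subr_eq0 => /eqP.
Qed.

Lemma closed_form0 z ps : closed_form z ps 0 = 0.
Proof. by rewrite /closed_form big_geq // oppr0. Qed.

End ClosedForm.

(** * Nested sums as sums over decreasing sequences *)

(** A list without repetition, so that a truncated nested sum is a single sum
    over it and also a partial sum of an unconditional sum. *)
Fixpoint decs (d n : nat) : seq (seq nat) :=
  if d is d'.+1 then [seq k :: ks | k <- iota 1 n, ks <- decs d' k] else [:: [::]].

Lemma mem_decs d n ks :
  (ks \in decs d n) = [&& size ks == d, path geq n ks & all (leq 1) ks].
Proof.
elim: d n ks => [|d IH] n ks; first by rewrite inE; case: ks.
apply/allpairsPdep/idP => /= [[k [ks' [kI ks'I ->]]]|].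
  move: ks'I; rewrite IH => /and3P[/eqP <- pk ak] /=.
  by move: kI; rewrite mem_iota add1n ltnS => /andP[-> ->]; rewrite eqxx pk ak.
case: ks => [//|k ks] /= /and3P[sk /andP[kn pk] /andP[k0 ak]].
exists k, ks; split=> //; first by rewrite mem_iota add1n ltnS k0.
by rewrite IH -eqSS sk pk.
Qed.

Lemma decs_uniq d n : uniq (decs d n).
Proof.
elim: d n => [|d IH] n //=; apply: allpairs_uniq_dep; rewrite ?iota_uniq //.
by move=> [a x] [b y] _ _ /= [-> ->].
Qed.

Lemma sum_decsS (V : nmodType) d n (G : seq nat -> V) :
  \sum_(ks <- decs d.+1 n) G ks
  = \sum_(1 <= k < n.+1) \sum_(ks <- decs d k) G (k :: ks).
Proof. by rewrite /= big_allpairs_dep /index_iota subSS subn0. Qed.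

Definition dec_pos (d : nat) (ks : seq nat) : bool :=
  (size ks == d) && weakly_decreasing_pos ks.

Lemma dec_pos_decs d ks n : dec_pos d ks -> (head 0%N ks <= n)%N ->
  ks \in decs d n.
Proof.
rewrite mem_decs => /and3P[->]; case: ks => [//|k ks] /= -> ->.
by rewrite andbT => ->.
Qed.

Lemma decs_dec_pos d ks n : ks \in decs d n -> dec_pos d ks.
Proof.
by rewrite mem_decs /dec_pos /weakly_decreasing_pos => /and3P[-> /path_sorted -> ->].
Qed.

Section Decreasing.
Variable F : numFieldType.

(** These lists exhaust the index set, so bounding the sums over them is
    enough. *)
Lemma abs_bounded_decs d (G : seq nat -> F) (M : F) :
  (forall n, \sum_(ks <- decs d n) `|G ks| <= M) -> abs_bounded (dec_pos d) G M.
Proof.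
move=> GM B uB; pose N := \max_(ks <- B) head 0%N ks.
apply: le_trans (GM N).
have -> : \sum_(ks <- decs d N) `|G ks| = \sum_(ks <- decs d N | dec_pos d ks) `|G ks|.
  by rewrite [RHS]big_seq_cond [LHS]big_seq; apply: eq_bigl => ks; case: (boolP (ks \in _)) => // /decs_dec_pos ->.
apply: ler_sum_sub => //; first exact: decs_uniq.
move=> ks ksB /dec_pos_decs; apply.
exact: (@leq_bigmax_seq _ _ xpredT (head 0%N)).
Qed.

Fixpoint chain (ps : seq (nat * F)) (k' : nat) (ks : seq nat) : F :=
  match ps, ks with
  | (c, z) :: ps', k :: ks' => factor c (next_entry ps') z k' k * chain ps' k ks'
  | _, _ => 1
  end.

Lemma sum_chain ps n k' : n = k' ->
  \sum_(ks <- decs (size ps) n) chain ps k' ks = tail ps k'.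
Proof.
elim: ps n k' => [|[c z] ps IH] n k' ->; first by rewrite /= big_seq1.
rewrite [size _]/= sum_decsS /=; apply: eq_bigr => k _.
by rewrite -(IH k k) // mulr_sumr.
Qed.

Definition full_term (z0 : F) ps (ks : seq nat) : F := chain ((1%N, z0) :: ps) 0 ks.

Lemma sum_full_term z0 ps n :
  - \sum_(ks <- decs (size ps).+1 n) kernel F n (head 0%N ks) * full_term z0 ps ks
  = closed_form z0 ps n.
Proof.
rewrite sum_decsS /closed_form; congr (- _); apply: eq_bigr => k _.
by rewrite /head_term -(sum_chain _ (erefl k)) !mulr_sumr.
Qed.

(** A rational substitute for the square root of [k]: sums of [growth k / k]
    reproduce [growth] up to a constant, however many layers are nested, and
    the sum of [growth k / k ^ 2] still converges. *)
Definition growth (k : nat) : F := \prod_(j < k) (1 + (2 * j.+1%:R)^-1).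

Lemma growthS k : growth k.+1 = growth k * (1 + (2 * k.+1%:R)^-1).
Proof. by rewrite /growth big_ord_recr. Qed.

Lemma growth_gt0 k : 0 < growth k.
Proof. by apply: prodr_gt0 => j _; rewrite addr_gt0 // invr_gt0 mulr_gt0. Qed.

Lemma growth_leS k : growth k <= growth k.+1.
Proof.
by rewrite growthS ler_peMr ?ltW ?growth_gt0 // ltrDl invr_gt0 mulr_gt0.
Qed.

Lemma growth_le j k : (j <= k)%N -> growth j <= growth k.
Proof.
elim: k => [|k IH]; first by rewrite leqn0 => /eqP ->.
by rewrite leq_eqVlt => /orP[/eqP->//|/IH h]; exact: le_trans h (growth_leS k).
Qed.

Lemma sum_growth_div n : \sum_(1 <= k < n.+1) growth k / k%:R <= 3 * growth n.
Proof.
elim: n => [|n IH]; first by rewrite big_geq // mulr_ge0 // ltW ?growth_gt0.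
rewrite big_nat_recr //=; apply: le_trans (lerD IH (lexx _)) _.
rewrite -subr_ge0 growthS; set u := growth n; have n0 := natr_neq0 F n.
have -> : 3 * (u * (1 + (2 * n.+1%:R)^-1))
    - (3 * u + u * (1 + (2 * n.+1%:R)^-1) / n.+1%:R)
    = u * n%:R / (2 * n.+1%:R ^+ 2).
  by rewrite -natr1 in n0 *; field.
by rewrite divr_ge0 // mulr_ge0 // ltW ?growth_gt0.
Qed.

Lemma sum_growth_sqr n :
  \sum_(1 <= k < n.+1) growth k / k%:R ^+ 2 <= 6 - 6 * growth n / n.+1%:R.
Proof.
elim: n => [|n IH].
  by rewrite big_geq // /growth big_ord0 mulr1 divr1 subrr.
rewrite big_nat_recr //=; apply: le_trans (lerD IH (lexx _)) _.
rewrite -subr_ge0 growthS; set u := growth n.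
have n0 := natr_neq0 F n; have n1 := natr_neq0 F n.+1.
have -> : 6 - 6 * (u * (1 + (2 * n.+1%:R)^-1)) / n.+2%:R
    - (6 - 6 * u / n.+1%:R + u * (1 + (2 * n.+1%:R)^-1) / n.+1%:R ^+ 2)
    = u * n%:R * (4 * n.+1%:R + 1) / (2 * n.+1%:R ^+ 3 * n.+2%:R).
  by rewrite -[n.+2%:R]natr1 -natr1 in n0 n1 *; field; rewrite n0 n1.
by rewrite divr_ge0 // mulr_ge0 ?addr_ge0 ?mulr_ge0 // ltW ?growth_gt0.
Qed.

Lemma sharp_ge0 r k m : 0 <= sharp F r k m.
Proof.
elim: r k => [|x r IH] k /=; first by rewrite exprn_ge0.
by apply: sumr_ge0 => l _; rewrite mulr_ge0 // divr_ge0 // exprn_ge0.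
Qed.

Lemma expr2_Delta_le k m : (2 : F) ^+ Delta k m <= 2.
Proof. by rewrite /Delta; case: eqP => _; rewrite ?expr0 ?expr1 ?ler1n. Qed.

Lemma sum_sharp_growth r n :
  \sum_(1 <= k < n.+1) sharp F (nseq r 1%N) n k * (growth k / k%:R)
  <= 6 ^+ r.+1 * growth n.
Proof.
have u0 k : 0 <= growth k / k%:R by rewrite divr_ge0 // ltW ?growth_gt0.
elim: r n => [|r IH] n /=.
  apply: (@le_trans _ _ (2 * \sum_(1 <= k < n.+1) growth k / k%:R)).
    by rewrite mulr_sumr; apply: ler_sum => k _; rewrite ler_wpM2r // expr2_Delta_le.
  apply: le_trans (ler_wpM2l _ (sum_growth_div n)) _ => //.
  by rewrite mulrA -natrM expr1.
under eq_bigr do rewrite mulr_suml.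
rewrite -(exchange_triangle (fun l k => 2 ^+ Delta n l / l%:R ^+ 1
   * sharp F (nseq r 1%N) l k * (growth k / k%:R))).
apply: (@le_trans _ _ (\sum_(1 <= l < n.+1) 2 * 6 ^+ r.+1 * (growth l / l%:R))).
  apply: ler_sum => l _.
  have -> : 2 * 6 ^+ r.+1 * (growth l / l%:R) = 2 / l%:R * (6 ^+ r.+1 * growth l).
    by ring.
  apply: le_trans (ler_wpM2l _ (IH l)); last by rewrite divr_ge0.
  rewrite mulr_sumr; apply: ler_sum => k _; rewrite -!mulrA expr1.
  by rewrite ler_wpM2r ?expr2_Delta_le // !mulr_ge0 ?invr_ge0 ?sharp_ge0 // ltW ?growth_gt0.
rewrite -mulr_sumr; apply: le_trans (ler_wpM2l _ (sum_growth_div n)) _.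
  by rewrite mulr_ge0 // exprn_ge0.
by rewrite [in leRHS]exprS le_eqVlt; apply/orP; left; apply/eqP; ring.
Qed.

End Decreasing.

(** * Absolute summability of the right-hand side *)

Section Bounds.
Variable F : numFieldType.
Implicit Types (z : F) (ps : seq (nat * F)).

Lemma sqr_dist_ge z k : `|z| < 1 -> (0 < k)%N ->
  k%:R ^+ 2 * (1 - `|z| ^+ 2) <= `|k%:R ^+ 2 - z ^+ 2|.
Proof.
move=> z1 k0; apply: le_trans (lerB_dist _ _).
rewrite !normrX normr_nat mulrBr mulr1 lerB // ler_peMl ?exprn_ge0 //.
by rewrite exprn_ege1 // ler1n.
Qed.

Lemma one_sub_sqr_gt0 z : `|z| < 1 -> 0 < 1 - `|z| ^+ 2.
Proof. by move=> z1; rewrite subr_gt0 exprn_ilt1. Qed.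

Lemma sqr_dist_neq0 z : `|z| < 1 ->
  forall k, (0 < k)%N -> k%:R ^+ 2 - z ^+ 2 != 0.
Proof.
move=> z1 k k0; rewrite -normr_gt0; apply: lt_le_trans (sqr_dist_ge z1 k0).
by rewrite mulr_gt0 ?one_sub_sqr_gt0 // exprn_gt0 // ltr0n.
Qed.

Lemma factor_le c c' z k' k : `|z| < 1 -> (0 < k)%N ->
  `|factor c c' z k' k| <= (1 - `|z| ^+ 2)^-1 *
     (k%:R ^+ delta c * k%:R ^+ delta c' / k%:R ^+ 3
      * sharp F (nseq (c - 3) 1%N) k' k).
Proof.
move=> z1 k0; have kp : 0 < k%:R :> F by rewrite ltr0n.
have s0 := sharp_ge0 F (nseq (c - 3) 1%N) k' k.
have nE i : `|((-1) ^+ k * k%:R : F) ^+ i| = k%:R ^+ i.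
  by rewrite normrX normrM normrX normrN1 expr1n mul1r normr_nat.
rewrite factorE // !normrM !nE !normfV normr_nat (ger0_norm s0) mulrA.
apply: ler_wpM2r => //.
set a := _ ^+ _; set b := _ ^+ _.
have -> : (1 - `|z| ^+ 2)^-1 * (a * b / k%:R ^+ 3)
    = a * b / k%:R * (k%:R ^+ 2 * (1 - `|z| ^+ 2))^-1.
  by field; rewrite !gt_eqF ?one_sub_sqr_gt0.
apply: ler_wpM2l; first by rewrite divr_ge0 ?mulr_ge0 ?exprn_ge0.
rewrite lef_pV2 ?sqr_dist_ge // posrE ?normr_gt0 ?sqr_dist_neq0 //.
by rewrite mulr_gt0 ?exprn_gt0 ?one_sub_sqr_gt0.
Qed.

Definition in_disc ps := forall p, p \in ps -> `|p.2| < 1.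

(** The layer of an entry 1 costs one more power of [n] than the layer of an
    entry at least 3. The exponents [delta] compensate for this: whatever the
    next entry [c'] is, [k ^ delta c'] times the bound on the inner layers is at
    most a constant times [k ^ 2 * growth k]. *)
Lemma chain_le ps : admissible ps -> in_disc ps -> exists2 C, 0 <= C &
  forall n, \sum_(ks <- decs (size ps) n) `|chain ps n ks|
    <= C * (n%:R ^+ (next_entry ps == 1%N) * growth F n).
Proof.
elim: ps => [|[c z] ps IH] /=.
  move=> _ _; exists 1 => // n; rewrite big_seq1 normr1 expr0 !mul1r.
  by have := growth_le F (leq0n n); rewrite {1}/growth big_ord0.
move=> /andP[/andP[/= c0 c2] aps] dps.
have z1 : `|z| < 1 by apply: (dps (c, z)); rewrite mem_head.
have [|C C0 hC] := IH aps; first by move=> p pps; apply: dps; rewrite inE pps orbT.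
set Cz := (1 - `|z| ^+ 2)^-1; have Cz0 : 0 < Cz by rewrite invr_gt0 one_sub_sqr_gt0.
exists (Cz * C * 6 ^+ (c - 3).+1) => [|n].
  by rewrite !mulr_ge0 ?exprn_ge0 // ltW.
rewrite sum_decsS.
have u0 k : 0 <= growth F k / k%:R by rewrite divr_ge0 // ltW ?growth_gt0.
apply: (@le_trans _ _ (\sum_(1 <= k < n.+1) Cz * C * n%:R ^+ (c == 1%N) *
   (sharp F (nseq (c - 3) 1%N) n k * (growth F k / k%:R)))).
  apply: ler_sum_nat => k /andP[k0 kn].
  have kp : 0 < k%:R :> F by rewrite ltr0n.
  have -> : \sum_(ks <- decs (size ps) k) `|chain ((c, z) :: ps) n (k :: ks)|
      = `|factor c (next_entry ps) z n k|
        * \sum_(ks <- decs (size ps) k) `|chain ps k ks|.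
    by rewrite mulr_sumr; apply: eq_bigr => ks _; rewrite /= normrM.
  apply: le_trans (ler_pM _ _ (factor_le c (next_entry ps) n z1 k0) (hC k)) _.
  - exact: normr_ge0.
  - exact: sumr_ge0.
  rewrite -/Cz; set s := sharp _ _ _ _; have s0 : 0 <= s by apply: sharp_ge0.
  set u := growth F k; set a := (_ ^+ delta c).
  set b := (_ ^+ delta (next_entry ps)); set b' := _ ^+ (_ == _).
  have bb : b * b' <= k%:R ^+ 2.
    rewrite -exprD; apply: ler_weXn2l; first by rewrite ler1n.
    by case: (next_entry ps) => [|[|]].
  have ac : a <= n%:R ^+ (c == 1%N).
    rewrite /a (_ : delta c = (c == 1%N)); last first.
      by case: (c) c0 c2 => [|[|[|]]].
    by rewrite lerXn2r ?nnegrE // ler_nat.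
  have -> : Cz * (a * b / k%:R ^+ 3 * s) * (C * (b' * u))
      = Cz * C * (a * (b * b' / k%:R ^+ 2 * (s * (u / k%:R)))).
    by field; rewrite gt_eqF.
  rewrite -[leRHS]mulrA; apply: ler_wpM2l; first by rewrite mulr_ge0 // ltW.
  have su0 : 0 <= s * (u / k%:R) by apply: mulr_ge0 => //; apply: u0.
  have a0 : 0 <= a by rewrite exprn_ge0.
  apply: ler_pM => //.
    by rewrite mulr_ge0 // divr_ge0 // ?mulr_ge0 ?exprn_ge0.
  by rewrite ler_piMl // ler_pdivrMr ?exprn_gt0 // mul1r.
rewrite -mulr_sumr; apply: le_trans (ler_wpM2l _ (sum_sharp_growth F (c - 3) n)) _.
  by rewrite !mulr_ge0 ?exprn_ge0 // ltW.
by rewrite le_eqVlt; apply/orP; left; apply/eqP; ring.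
Qed.

(** Here [3 <= c_1] enters: it leaves [growth k / k ^ 2] for the outermost sum. *)
Lemma full_term_bounded z0 ps : `|z0| < 1 -> admissible ps -> in_disc ps ->
  (3 <= next_entry ps)%N ->
  exists M, abs_bounded (dec_pos (size ps).+1) (full_term z0 ps) M.
Proof.
move=> z1 aps dps c3; have [C C0 hC] := chain_le aps dps.
set Cz := (1 - `|z0| ^+ 2)^-1; have Cz0 : 0 < Cz by rewrite invr_gt0 one_sub_sqr_gt0.
exists (2 * Cz * C * 6); apply: abs_bounded_decs => n; rewrite sum_decsS.
have d0 : delta (next_entry ps) = 0%N by case: (next_entry ps) c3 => [|[|]].
have n1 : (next_entry ps == 1%N) = false by case: (next_entry ps) c3 => [|[|]].
apply: (@le_trans _ _ (\sum_(1 <= k < n.+1) 2 * Cz * C * (growth F k / k%:R ^+ 2))).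
  apply: ler_sum_nat => k /andP[k0 kn].
  have kp : 0 < k%:R :> F by rewrite ltr0n.
  have -> : \sum_(ks <- decs (size ps) k) `|full_term z0 ps (k :: ks)|
      = `|factor 1 (next_entry ps) z0 0 k|
        * \sum_(ks <- decs (size ps) k) `|chain ps k ks|.
    by rewrite mulr_sumr; apply: eq_bigr => ks _; rewrite /full_term /= normrM.
  apply: le_trans (ler_pM _ _ (factor_le 1 (next_entry ps) 0 z1 k0) (hC k)) _.
  - exact: normr_ge0.
  - exact: sumr_ge0.
  rewrite -/Cz d0 n1 /= /Delta ltn_eqF //.
  by rewrite le_eqVlt; apply/orP; left; apply/eqP; field; rewrite gt_eqF.
rewrite -mulr_sumr; apply: ler_wpM2l; first by rewrite !mulr_ge0 // ltW.
apply: le_trans (sum_growth_sqr F n) _.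
by rewrite gerBl divr_ge0 // mulr_ge0 // ltW ?growth_gt0.
Qed.

Lemma kernel_ge0 n k : 0 <= kernel F n k.
Proof.
case: (ltnP n k) => [/kernel_gt ->//|kn]; apply: prodr_ge0 => j _.
by rewrite divr_ge0 // subr_ge0 ler_nat ltnW // (leq_trans (ltn_ord j)).
Qed.

Lemma kernel_le1 n k : kernel F n k <= 1.
Proof.
case: (ltnP n k) => [/kernel_gt ->//|kn]; apply: prodr_ile1 => j _.
have jn : (j <= n)%N by rewrite ltnW // (leq_trans (ltn_ord j)).
rewrite divr_ge0 ?subr_ge0 ?ler_nat //= -natrB // ler_pdivrMr ?ltr0n; last by lia.
by rewrite mul1r ler_nat; lia.
Qed.

(** By [kernel_pair], [n] times one step of the kernel is at most [2 k + 1]. *)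
Lemma kernel_near1 n k : n%:R * (1 - kernel F n k) <= k%:R ^+ 2.
Proof.
elim: k => [|k IH]; first by rewrite /kernel big_ord0 subrr mulr0 expr0n.
rewrite (_ : n%:R * _ = n%:R * (1 - kernel F n k)
   + n%:R * (kernel F n k - kernel F n k.+1)); last by ring.
rewrite -kernel_pair.
apply: le_trans (lerD IH (lerD (ler_wpM2l _ (kernel_le1 n k))
  (ler_wpM2l _ (kernel_le1 n k.+1)))) _ => //.
by rewrite -natr1 le_eqVlt; apply/orP; left; apply/eqP; ring.
Qed.

End Bounds.

(** * The truncated generating series *)

Fixpoint trunc_zeta (F : numFieldType) (s : seq nat) (n : nat) : F :=
  if s is x :: s' then \sum_(1 <= k < n.+1) k%:R ^- x * trunc_zeta F s' k else 1.

(** The string ({2}^(a_0), c_1, {2}^(a_1), ..., c_d, {2}^(a_d)). *)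
Fixpoint entries (T : Type) (ps : seq (nat * T)) (a : seq nat) {struct a} : seq nat :=
  if a is a0 :: a' then
    nseq a0 2 ++ (if ps is (c, _) :: ps' then c :: entries ps' a' else [::])
  else [::].

Section TruncZeta.
Variable F : numFieldType.
Implicit Types (z : F) (ps : seq (nat * F)).
Notation tz := (trunc_zeta F).

Lemma trunc_zetaS x s n :
  tz (x :: s) n.+1 = tz (x :: s) n + n.+1%:R ^- x * tz s n.+1.
Proof. by rewrite /= big_nat_recr. Qed.

Lemma trunc_zeta_ge0 s n : 0 <= tz s n.
Proof.
elim: s n => [|x s IH] n //=; apply: sumr_ge0 => k _.
by rewrite mulr_ge0 // invr_ge0 exprn_ge0.
Qed.

Lemma trunc_zeta_leS s n : tz s n <= tz s n.+1.
Proof.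
by case: s => [|x s] //; rewrite trunc_zetaS lerDl mulr_ge0 ?trunc_zeta_ge0.
Qed.

Lemma trunc_zeta_le s m n : (m <= n)%N -> tz s m <= tz s n.
Proof.
elim: n => [|n IH]; first by rewrite leqn0 => /eqP ->.
by rewrite leq_eqVlt => /orP[/eqP->//|/IH h]; exact: le_trans h (trunc_zeta_leS s n).
Qed.

Fixpoint monomial (z0 : F) ps (a : seq nat) {struct a} : F :=
  if a is a0 :: a' then
    z0 ^+ (2 * a0) * (if ps is (_, z) :: ps' then monomial z ps' a' else 1)
  else 1.

Definition gen_term z0 ps n a : F := tz (entries ps a) n * monomial z0 ps a.

Lemma gen_termS z0 ps n a0 a : gen_term z0 ps n.+1 (a0.+1 :: a)
  = gen_term z0 ps n (a0.+1 :: a)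
    + z0 ^+ 2 / n.+1%:R ^+ 2 * gen_term z0 ps n.+1 (a0 :: a).
Proof.
rewrite /gen_term (_ : entries ps (a0.+1 :: a) = 2%N :: entries ps (a0 :: a)) //.
by rewrite trunc_zetaS /= mulnS exprD; ring.
Qed.

Lemma gen_term_cons z0 c z ps n a : gen_term z0 ((c, z) :: ps) n.+1 (0%N :: a)
  = gen_term z0 ((c, z) :: ps) n (0%N :: a) + n.+1%:R ^- c * gen_term z ps n.+1 a.
Proof.
rewrite /gen_term (_ : entries _ (0%N :: a) = c :: entries ps a) //.
by rewrite trunc_zetaS /= muln0 expr0 mul1r; ring.
Qed.

Lemma gen_term_nil z0 n : gen_term z0 [::] n [:: 0%N] = 1.
Proof. by rewrite /gen_term /= muln0 expr0 !mulr1. Qed.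

Lemma gen_term0 z0 ps a : (ps != [::]) || (a != [:: 0%N]) -> size a = (size ps).+1 ->
  gen_term z0 ps 0 a = 0.
Proof.
case: a => [|a0 a] // h /= [sa]; rewrite /gen_term.
suff : size (entries ps (a0 :: a)) != 0%N.
  case: (entries _ _) => // x s _; rewrite /= big_geq ?mul0r //.
case: ps h sa => [|[c z] ps] h sa; rewrite /= size_cat size_nseq /=; last by rewrite addnS.
by move: h; rewrite orFb addn0; apply: contraNneq => ->; rewrite (size0nil sa).
Qed.

(** The empty string has the value 1 also for the truncation at 0, where the
    closed form is an empty sum. *)
Definition gen_value z0 ps n : F :=
  if (ps == [::]) && (n == 0%N) then 1 else closed_form z0 ps n.

End TruncZeta.

Lemma sqr_ratio_lt1 (F : numFieldType) (z : F) n :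
  `|z| < 1 -> `|z ^+ 2 / n.+1%:R ^+ 2| < 1.
Proof.
move=> z1; rewrite normrM normfV !normrX normr_nat.
rewrite ltr_pdivrMr ?exprn_gt0 ?ltr0n // mul1r (@lt_le_trans _ _ 1) //.
  by rewrite exprn_ilt1.
by rewrite exprn_ege1 // ler1n.
Qed.

Section GenSum.
Variable R : realType.
Local Notation C := R[i].
Implicit Types (z : C) (ps : seq (nat * C)).

(** The shift of [a_0]. The empty sequence is a fixed point only to make the
    shift injective with a partial inverse; it is never an index. *)
Definition incr_head (a : seq nat) : seq nat :=
  if a is a0 :: a' then a0.+1 :: a' else [::].
Definition decr_head (a : seq nat) : option (seq nat) :=
  match a with a0.+1 :: a' => Some (a0 :: a') | 0%N :: _ => None | [::] => Some [::] end.
Definition drop_zero (a : seq nat) : option (seq nat) :=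
  if a is 0%N :: a' then Some a' else None.

Lemma incr_headK : pcancel incr_head decr_head. Proof. by case. Qed.
Lemma decr_headK : ocancel decr_head incr_head. Proof. by case=> [|[|a0] a]. Qed.
Lemma cons0K : pcancel (cons 0%N) drop_zero. Proof. by []. Qed.
Lemma drop_zeroK : ocancel drop_zero (cons 0%N). Proof. by case=> [|[|a0] a]. Qed.

(** The terms with [a_0 > 0] reproduce the series with the factor
    [z0 ^ 2 / n ^ 2], those with [a_0 = 0] give the series of the shorter list;
    hence the recursion that the closed form also satisfies. *)
Lemma gen_term_sum z0 ps n : `|z0| < 1 -> admissible ps -> in_disc ps ->
  (exists M, abs_bounded (fun a => size a == (size ps).+1) (gen_term z0 ps n) M)
  /\ has_sum (fun a => size a == (size ps).+1) (gen_term z0 ps n) (gen_value z0 ps n).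
Proof.
elim: ps z0 n => [|[c z] ps IHps] z0 n z01 aps dps; elim: n => [|n [[M IHM] IHn]].
- have u0 : uniq [:: [:: 0%N]] by [].
  have f0 a : size a == 1%N -> a \notin [:: [:: 0%N]] -> gen_term z0 [::] 0 a = 0.
    by move=> /eqP sa; rewrite inE => a0; apply: gen_term0.
  split; first by eexists; exact: abs_bounded_finite u0 f0.
  by have := has_sum_finite u0 f0; rewrite big_cons big_nil /= gen_term_nil addr0.
- have q1 := sqr_ratio_lt1 n z01.
  have Pi a : (size (incr_head a) == 1%N) = (size a == 1%N) by case: a.
  have rk a : size a == 1%N -> (head 0 a < head 0 (incr_head a))%N by case: a.
  have fE a : size a == 1%N -> gen_term z0 [::] n.+1 a = gen_term z0 [::] n a
      + z0 ^+ 2 / n.+1%:R ^+ 2 * oapp (gen_term z0 [::] n.+1) 0 (decr_head a).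
    case: a => [//|[|a0] [|//]] _; last by rewrite gen_termS.
    by rewrite !gen_term_nil mulr0 addr0.
  have [fM fs] := has_sum_geometric incr_headK decr_headK Pi rk q1 fE IHM IHn.
  split; first by eexists; exact: fM.
  suff -> : gen_value z0 [::] n.+1
      = gen_value z0 [::] n / (1 - z0 ^+ 2 / n.+1%:R ^+ 2) by [].
  apply: (mulIf (one_sub_neq0 q1)); rewrite divfK ?one_sub_neq0 // mulrC.
  rewrite closed_form_nil; last exact: sqr_dist_neq0.
  by case: (n).
- have f0 a : size a == (size ps).+2 -> a \notin [::] ->
      gen_term z0 ((c, z) :: ps) 0 a = 0.
    by move=> /eqP sa _; apply: gen_term0.
  split; first by eexists; exact: abs_bounded_finite f0.
  by have := has_sum_finite (isT : uniq [::]) f0; rewrite big_nil /gen_value closed_form0.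
- have q1 := sqr_ratio_lt1 n z01.
  have z1 : `|z| < 1 by apply: (dps (c, z)); rewrite mem_head.
  have dps' : in_disc ps by move=> p pps; apply: dps; rewrite inE pps orbT.
  have /andP[/andP[/= c0 /eqP c2] aps'] := aps.
  have [[M' IHM'] IHs'] := IHps z n.+1 z1 aps' dps'.
  have Pc a : (size (0%N :: a) == (size ps).+2) = (size a == (size ps).+1) by [].
  have gM := abs_boundedD IHM (abs_boundedZ (n.+1%:R ^- c)
    (abs_bounded_push drop_zeroK Pc IHM')).
  have gs := has_sumD IHn (has_sumZ (n.+1%:R ^- c)
    (has_sum_push cons0K drop_zeroK Pc IHs')).
  have Pi a : (size (incr_head a) == (size ps).+2) = (size a == (size ps).+2) by case: a.
  have rk a : size a == (size ps).+2 -> (head 0 a < head 0 (incr_head a))%N by case: a.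
  have fE a : size a == (size ps).+2 ->
      gen_term z0 ((c, z) :: ps) n.+1 a = (gen_term z0 ((c, z) :: ps) n a
        + n.+1%:R ^- c * oapp (gen_term z ps n.+1) 0 (drop_zero a))
      + z0 ^+ 2 / n.+1%:R ^+ 2
        * oapp (gen_term z0 ((c, z) :: ps) n.+1) 0 (decr_head a).
    case: a => [//|[|a0] a] _; last by rewrite gen_termS mulr0 addr0.
    by rewrite gen_term_cons mulr0 addr0.
  have [fM fs] := has_sum_geometric incr_headK decr_headK Pi rk q1 fE gM gs.
  split; first by eexists; exact: fM.
  suff -> : gen_value z0 ((c, z) :: ps) n.+1 = (gen_value z0 ((c, z) :: ps) n
      + n.+1%:R ^- c * gen_value z ps n.+1) / (1 - z0 ^+ 2 / n.+1%:R ^+ 2) by [].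
  apply: (mulIf (one_sub_neq0 q1)); rewrite divfK ?one_sub_neq0 // mulrC /gen_value !andbF.
  by rewrite closed_form_cons //; exact: sqr_dist_neq0.
Qed.

End GenSum.

(** * Multiple sharp sums, zeta-star values and products of factors *)

Section Sharp.
Variable F : numFieldType.

Lemma path_geq_rcons k s m : path geq k (rcons s m) -> (m <= k)%N.
Proof.
elim: s k => [|x s IH] k /=; first by rewrite andbT.
by move=> /andP[xk /IH mx]; apply: leq_trans mx xk.
Qed.

Lemma sum_tuple_cons (T : finType) n (P : pred (seq T)) (G : seq T -> F) :
  \sum_(t : n.+1.-tuple T | P t) G t
  = \sum_(x : T) \sum_(t : n.-tuple T | P (x :: t)) G (x :: t).
Proof.
rewrite (reindex (fun p : T * n.-tuple T => [tuple of p.1 :: p.2])) /=.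
  by rewrite -(pair_big_dep xpredT (fun x (t : n.-tuple T) => P (x :: t))
    (fun x (t : n.-tuple T) => G (x :: t))).
exists (fun t => (thead t, [tuple of behead t])) => [[x t] _|t _] /=.
  by congr (_, _); apply: val_inj.
by rewrite [in RHS](tuple_eta t).
Qed.

(** The range [0, K] of the indices is kept fixed in the induction, in which the
    upper bound [k] on the outermost index varies. *)
Lemma sharp_sum r K k m : (m <= k <= K)%N ->
  \sum_(l : (size r).-tuple 'I_K.+1 | path geq k (rcons [seq val j | j <- l] m))
     2%:R ^+ sumn (pairmap Delta k (rcons [seq val j | j <- l] m))
     / \prod_(i < size r) (nth 0%N [seq val j | j <- l] i)%:R ^+ nth 0%N r i
  = sharp F r k m.
Proof.
elim: r k => [|x r IH] k /andP[mk kK].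
  rewrite (big_pred1 [tuple]) => [|t]; last by rewrite tuple0 /= mk eqxx.
  by rewrite /= big_ord0 divr1 addn0.
rewrite [size _]/= (sum_tuple_cons (size r)
  (fun l => path geq k (rcons [seq val j | j <- l] m))
  (fun l => 2%:R ^+ sumn (pairmap Delta k (rcons [seq val j | j <- l] m))
     / \prod_(i < (size r).+1)
        (nth 0%N [seq val j | j <- l] i)%:R ^+ nth 0%N (x :: r) i)) /=.
rewrite (big_nat_widen _ _ K.+1) // big_geq_mkord [RHS]big_mkcond /=.
apply: eq_bigr => j _; rewrite ltnS.
case: (boolP ((j <= k)%N && (m <= j)%N)) => [/andP[jk mj]|jkm].
  rewrite -IH ?mj /=; last by rewrite -ltnS.
  rewrite mulr_sumr; apply: eq_big => [t|t _]; first by rewrite jk.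
  by rewrite exprD big_ord_recl /= invfM -!mulrA; congr (_ * _); rewrite mulrCA.
apply: big1 => t /andP[jk /path_geq_rcons mj].
by rewrite jk mj in jkm.
Qed.

Lemma multiple_sharpE r k m : (r == [::]) || (m <= k)%N ->
  multiple_sharp F k m r = sharp F r k m.
Proof.
rewrite /multiple_sharp; case: r => [//|x r] mk.
have {}mk : (m <= k)%N := mk.
rewrite ltnNge mk [_ || _]/= -(sharp_sum (x :: r) (K := k)) ?mk ?leqnn //.
apply: eq_bigr => l _; congr (_ / _); apply: eq_bigr => i _.
by rewrite (nth_map ord0) ?size_tuple // -tnth_nth.
Qed.

End Sharp.

Section ZetaStar.
Variable R : realType.

Lemma esum_has_sum (T : choiceType) (P : pred T) (f : T -> R) (L : R) :
  (forall x, P x -> 0 <= f x) -> has_sum P f L ->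
  (\esum_(x in [set x | P x]%classic) (f x)%:E = L%:E)%E.
Proof.
move=> f0 fL.
have L0 : 0 <= L.
  rewrite leNgt; apply/negP => L0; have e0 : 0 < - L by rewrite oppr_gt0.
  have [A hA] := fL _ e0; have sA : {subset A <= undup A}.
    by move=> x; rewrite mem_undup.
  have := hA _ (undup_uniq A) sA; rewrite ltNge => /negP; apply.
  by apply: le_trans (ler_norm _); rewrite lerDr sumr_ge0.
apply/eqP; rewrite eq_le; apply/andP; split.
  apply: ge_ereal_sup => _ [_ [/finite_seqP[A ->] sA] <-].
  have -> : [set` A]%classic = [set` undup A]%classic.
    by apply/seteqP; split=> x /=; rewrite mem_undup.
  rewrite -fsbig_seq ?undup_uniq // sumEFin lee_fin -(ger0_norm L0).
  rewrite big_seq (eq_bigl (fun x => (x \in undup A) && P x)); last first.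
    by move=> x; rewrite mem_undup; case: (boolP (x \in A)) => //= /sA ->.
  by rewrite -big_seq_cond; apply: has_sum_ge => //; apply: undup_uniq.
apply/lee_addgt0Pr => e e0; have [A hA] := fL e e0.
pose B := [seq x <- undup A | P x].
apply: (@le_trans _ _ ((\sum_(x <- B) f x)%:E + e%:E)%E).
  have sA : {subset A <= undup A} by move=> x; rewrite mem_undup.
  have := hA _ (undup_uniq A) sA; rewrite -big_filter distrC => h.
  by rewrite -EFinD lee_fin -lerBlDl ltW // (le_lt_trans (ler_norm _) h).
apply: leeD2r; apply: ereal_sup_ubound; exists [set` B]%classic.
  split; first exact: finite_seq.
  by move=> x /=; rewrite mem_filter => /andP[].
by rewrite -fsbig_seq ?sumEFin // filter_uniq // undup_uniq.
Qed.

Definition weight (s k : seq nat) : R :=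
  \prod_(i < size s) ((nth 0%N k i)%:R ^+ nth 0%N s i)^-1.

Lemma weight_ge0 s k : 0 <= weight s k.
Proof. by apply: prodr_ge0 => i _; rewrite invr_ge0 exprn_ge0. Qed.

Lemma sum_weight s n : \sum_(k <- decs (size s) n) weight s k = trunc_zeta R s n.
Proof.
elim: s n => [|x s IH] n; first by rewrite /= big_seq1 /weight big_ord0.
rewrite [size _]/= sum_decsS /=; apply: eq_bigr => k _; rewrite -IH mulr_sumr.
by apply: eq_bigr => ks _; rewrite /weight big_ord_recl.
Qed.

Lemma tends_decs d (G : seq nat -> R) (L : R) : has_sum (dec_pos d) G L ->
  tends (fun n => \sum_(ks <- decs d n) G ks) L.
Proof.
move=> GL e /GL[A hA]; exists (\max_(ks <- A) head 0%N ks) => n An.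
pose B := decs d n ++ [seq ks <- undup A | ~~ dec_pos d ks].
have uB : uniq B.
  rewrite cat_uniq decs_uniq filter_uniq ?undup_uniq // andbT.
  apply/hasPn => ks; rewrite mem_filter => /andP[nks _].
  by apply: contra nks; apply: decs_dec_pos.
have sB : {subset A <= B}.
  move=> ks ksA; rewrite mem_cat mem_filter mem_undup ksA andbT.
  case: (boolP (dec_pos d ks)) => dks; last by rewrite orbT.
  rewrite (dec_pos_decs dks) //; apply: leq_trans An.
  exact: (@leq_bigmax_seq _ _ xpredT (head 0%N)).
have := hA B uB sB; rewrite big_cat /= [X in _ + X - _]big1_seq ?addr0.
  rewrite (_ : \sum_(ks <- decs d n | _) _ = \sum_(ks <- decs d n) G ks) //.
  rewrite big_seq_cond [RHS]big_seq; apply: eq_bigl => ks.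
  by case: (boolP (ks \in _)) => // /decs_dec_pos ->.
by move=> ks /andP[dks]; rewrite mem_filter dks.
Qed.

(** Boundedness is needed for [fine] to return the value of the sum. *)
Lemma zeta_star_lim s (M : R) : (forall n, trunc_zeta R s n <= M) ->
  tends (trunc_zeta R s) (zeta_star R s)
  /\ forall n, trunc_zeta R s n <= zeta_star R s.
Proof.
move=> hM.
have wM : abs_bounded (dec_pos (size s)) (weight s) M.
  apply: abs_bounded_decs => n; rewrite (eq_bigr (weight s)) ?sum_weight //.
  by move=> k _; rewrite ger0_norm // weight_ge0.
have [L wL] := has_sum_real wM.
have PQ (k : (size s).-tuple nat) :
    dec_pos (size s) (val k) = weakly_decreasing_pos k.
  by rewrite /dec_pos size_tuple eqxx.
have wL' : has_sum (fun k : (size s).-tuple nat => weakly_decreasing_pos k)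
    (weight s \o val) L.
  apply: (@has_sum_pull _ _ _ _ _ val insub valK (insubK _) PQ _ _ _ wL).
  by move=> k /andP[sk _]; case: insubP => //; rewrite sk.
have zL : zeta_star R s = L.
  rewrite /zeta_star -[RHS]/(fine L%:E) -(esum_has_sum _ wL') => [|k _].
    congr fine; apply: eq_esum => k _ /=; congr (_%:E); apply: eq_bigr => i _.
    by rewrite (tnth_nth 0%N).
  exact: weight_ge0.
have tL : tends (trunc_zeta R s) L.
  move=> e e0; have [N hN] := tends_decs wL e0.
  by exists N => n /hN; rewrite sum_weight.
rewrite zL; split=> // n; rewrite leNgt; apply/negP => Ln.
have e0 : 0 < trunc_zeta R s n - L by rewrite subr_gt0.
have [N hN] := tL _ e0; have := hN _ (leq_maxl N n).
rewrite ltNge => /negP; apply; apply: le_trans (ler_norm _).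
by rewrite lerB // trunc_zeta_le // leq_maxr.
Qed.

End ZetaStar.

Section Products.
Variable F : numFieldType.

Lemma chain_prod (qs : seq (nat * F)) ks k' : size ks = size qs ->
  chain qs k' ks = \prod_(i < size qs)
    factor (nth 0%N (unzip1 qs) i) (nth 0%N (unzip1 qs) i.+1)
      (nth 0 (unzip2 qs) i) (nth 0%N (k' :: ks) i) (nth 0%N ks i).
Proof.
elim: qs ks k' => [|[c z] qs IH] [|k ks] k' //= => [_|[sk]]; first by rewrite big_ord0.
rewrite big_ord_recl /= IH //; congr (factor _ _ _ _ _ * _).
by case: (qs) => [|[]].
Qed.

Variables (T : Type) (fc : T -> nat) (fz : T -> F) (fa : T -> nat).

Lemma entries_map E a0 :
  entries [seq (fc i, fz i) | i <- E] (a0 :: [seq fa i | i <- E])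
  = nseq a0 2%N ++ flatten [seq fc i :: nseq (fa i) 2%N | i <- E].
Proof. by elim: E a0 => [|i E IH] a0 //=; rewrite -IH. Qed.

Lemma monomial_map E a0 z0 :
  monomial z0 [seq (fc i, fz i) | i <- E] (a0 :: [seq fa i | i <- E])
  = z0 ^+ (2 * a0) * \prod_(i <- E) fz i ^+ (2 * fa i).
Proof.
elim: E a0 z0 => [|i E IH] a0 z0; first by rewrite big_nil /=.
by rewrite big_cons -IH.
Qed.

End Products.

(** * The two sides in terms of the list of pairs *)

Section Bridge.
Variables (R : realType) (d : nat) (c : d.-tuple nat) (z : 'I_d.+1 -> R[i]).

Definition entry_pairs : seq (nat * R[i]) :=
  [seq (tnth c i, z (lift ord0 i)) | i <- enum 'I_d].

Lemma size_entry_pairs : size entry_pairs = d.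
Proof. by rewrite size_map size_enum_ord. Qed.

Lemma unzip1_entry_pairs : unzip1 entry_pairs = c.
Proof. by rewrite /unzip1 -map_comp /=; exact: map_tnth_enum. Qed.

Lemma tuple_head_behead (a : d.+1.-tuple nat) :
  a = tnth a ord0 :: [seq tnth a (lift ord0 i) | i <- enum 'I_d] :> seq nat.
Proof. by rewrite -[LHS]map_tnth_enum enum_ordSl /= -map_comp. Qed.

Lemma lhs_termE (a : d.+1.-tuple nat) :
  lhs_term c z a = (zeta_star R (entries entry_pairs a))%:C%C
    * monomial (z ord0) entry_pairs a.
Proof.
rewrite /lhs_term tuple_head_behead /entry_pairs entries_map monomial_map.
by rewrite big_ord_recl big_enum.
Qed.

Lemma rhs_termE (k : d.+1.-tuple nat) : weakly_decreasing_pos k ->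
  rhs_term c z k = full_term (z ord0) entry_pairs k.
Proof.
move=> /andP[/sortedP sk _].
rewrite /full_term chain_prod /= ?size_entry_pairs ?size_tuple //.
rewrite /rhs_term; apply: eq_bigr => i _.
have cE j : cext c j = nth 0%N (1%N :: unzip1 entry_pairs) j.
  rewrite unzip1_entry_pairs /cext; case: j => [//|j] /=.
  by rewrite nth_rcons if_same; case: ltnP => // cj; rewrite nth_default.
have zE : z i = nth 0 (z ord0 :: unzip2 entry_pairs) i.
  rewrite (_ : z ord0 :: _ = [seq z j | j <- enum 'I_d.+1]).
    by rewrite (nth_map i) ?size_enum_ord // nth_ord_enum.
  by rewrite enum_ordSl /= /unzip2 -!map_comp.
rewrite /factor /deltai !cE -zE (tnth_nth 0%N) multiple_sharpE //.
case: i zE => [[|i] hi] zE; first by [].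
by apply/orP; right; apply: (sk 0%N); rewrite size_tuple.
Qed.

End Bridge.

(** * Passage to the limit *)

Section Limit.
Variable R : realType.
Local Notation C := R[i].
Implicit Types (z : C) (ps : seq (nat * C)).

Definition abs_pairs ps : seq (nat * C) := [seq (p.1, `|p.2|) | p <- ps].

Lemma unzip1_abs ps : unzip1 (abs_pairs ps) = unzip1 ps.
Proof. by rewrite /unzip1 -map_comp. Qed.

Lemma entries_unzip1 (T U : Type) (ps : seq (nat * T)) (qs : seq (nat * U)) a :
  unzip1 ps = unzip1 qs -> entries ps a = entries qs a.
Proof.
elim: a ps qs => [//|a0 a IH] [|[c x] ps] [|[c' y] qs] //= [-> e].
by rewrite (IH _ _ e).
Qed.

Lemma norm_monomial z0 ps a :
  `|monomial z0 ps a| = monomial `|z0| (abs_pairs ps) a.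
Proof.
elim: a z0 ps => [|a0 a IH] z0 [|[c z] ps] /=; rewrite ?normr1 //.
  by rewrite mulr1 normrX mulr1.
by rewrite normrM normrX IH.
Qed.

Lemma norm_gen_term z0 ps n a :
  `|gen_term z0 ps n a| = gen_term `|z0| (abs_pairs ps) n a.
Proof.
rewrite /gen_term normrM norm_monomial ger0_norm ?trunc_zeta_ge0 //.
by rewrite (entries_unzip1 a (unzip1_abs ps)).
Qed.

Lemma next_entry_unzip1 ps : next_entry ps = head 0%N (unzip1 ps).
Proof. by case: ps => [|[]]. Qed.

Lemma admissible_unzip1 ps :
  admissible ps = all (fun c => (0 < c)%N && (c != 2%N)) (unzip1 ps).
Proof. by rewrite all_map. Qed.

Lemma gen_value_cf z0 ps n : ps != [::] -> gen_value z0 ps n = closed_form z0 ps n.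
Proof. by rewrite /gen_value => /negPf ->. Qed.

Lemma next_entry_nil ps : (3 <= next_entry ps)%N -> ps != [::].
Proof. by case: ps. Qed.

Lemma closed_form_bounded z0 ps : `|z0| < 1 -> admissible ps -> in_disc ps ->
  (3 <= next_entry ps)%N -> exists M, forall n, `|closed_form z0 ps n| <= M.
Proof.
move=> z1 aps dps c3; have [M hM] := full_term_bounded z1 aps dps c3.
exists M => n; rewrite -sum_full_term normrN.
apply: le_trans (ler_norm_sum _ _ _) _.
apply: le_trans (hM _ (decs_uniq (size ps).+1 n)).
rewrite big_seq [leRHS](eq_bigl (fun ks => true && dec_pos (size ps).+1 ks)) //.
rewrite [leRHS]big_seq_cond.
rewrite [leRHS](eq_bigl (fun ks => ks \in decs (size ps).+1 n)); last first.
  by move=> ks; case: (boolP (ks \in _)) => // /decs_dec_pos ->.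
apply: ler_sum => ks _; rewrite normrM ler_piMl //.
by rewrite ger0_norm ?kernel_ge0 ?kernel_le1.
Qed.

(** At the moduli [`|z_j|] the terms are the norms of the terms at the [z_j], so
    their finite sums are at most the sum of the series, a closed form. *)
Lemma gen_term_bounded z0 ps : `|z0| < 1 -> admissible ps -> in_disc ps ->
  (3 <= next_entry ps)%N -> exists M, forall n,
  abs_bounded (fun a => size a == (size ps).+1) (gen_term z0 ps n) M.
Proof.
move=> z1 aps dps c3.
have z1' : `| `|z0| | < 1 by rewrite normr_id.
have aps' : admissible (abs_pairs ps).
  by rewrite admissible_unzip1 unzip1_abs -admissible_unzip1.
have dps' : in_disc (abs_pairs ps).
  by move=> _ /mapP[p pps ->] /=; rewrite normr_id dps.
have c3' : (3 <= next_entry (abs_pairs ps))%N.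
  by rewrite next_entry_unzip1 unzip1_abs -next_entry_unzip1.
have [M hM] := closed_form_bounded z1' aps' dps' c3'.
exists M => n B uB; have [_ hs] := gen_term_sum n z1' aps' dps'.
rewrite gen_value_cf ?next_entry_nil // size_map in hs.
apply: le_trans (hM n); under eq_bigr do rewrite norm_gen_term.
by apply: has_sum_ge hs uB => a _; rewrite -norm_gen_term.
Qed.

Lemma trunc_zetaC s n : (trunc_zeta R s n)%:C%C = trunc_zeta C s n.
Proof.
elim: s n => [//|x s IH] n /=; rewrite rmorph_sum /=; apply: eq_bigr => k _.
by rewrite rmorphM /= fmorphV rmorphXn rmorph_nat IH.
Qed.

Lemma tends_complex (u : nat -> R) (l : R) :
  tends u l -> tends (fun n => (u n)%:C%C) (l%:C%C : C).
Proof.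
move=> h e e0.
have /andP[/eqP ie re] : (complex.Im e == 0) && (0 < complex.Re e).
  by move: e0; rewrite ltcE eq_sym.
have ee : e = (complex.Re e)%:C%C by case: e ie {e0 re} => x y /= ->.
have [N hN] := h _ re; exists N => n /hN.
rewrite ee -rmorphB /= normc_def /= expr0n /= addr0 sqrtr_sqr ltcR.
by [].
Qed.

Lemma monomial_gt0 z0 ps a : 0 < z0 -> (forall p, p \in ps -> 0 < p.2) ->
  0 < monomial z0 ps a.
Proof.
elim: a z0 ps => [|a0 a IH] z0 [|[c z] ps] //= z0p pp.
  by rewrite mulr1 exprn_gt0.
rewrite mulr_gt0 ?exprn_gt0 // IH // => [|p pps].
  by apply: (pp (c, z)); rewrite mem_head.
by apply: pp; rewrite inE pps orbT.
Qed.

(** The truncated values are bounded because the generating series at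
    [z_j = 1/2] is. *)
Lemma zeta_star_limC ps a : admissible ps -> (3 <= next_entry ps)%N ->
  size a = (size ps).+1 ->
  tends (trunc_zeta C (entries ps a)) (zeta_star R (entries ps a))%:C%C
  /\ forall n, trunc_zeta R (entries ps a) n <= zeta_star R (entries ps a).
Proof.
move=> aps c3 sa.
pose hs : seq (nat * C) := [seq (p.1, 2^-1) | p <- ps].
have hsE : unzip1 hs = unzip1 ps by rewrite /unzip1 -map_comp.
have half : `|2^-1 : C| < 1 by rewrite normfV normr_nat invf_lt1 ?ltr1n.
have aps' : admissible hs by rewrite admissible_unzip1 hsE -admissible_unzip1.
have dps' : in_disc hs by move=> _ /mapP[p pps ->].
have c3' : (3 <= next_entry hs)%N.
  by rewrite next_entry_unzip1 hsE -next_entry_unzip1.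
have [M hM] := gen_term_bounded half aps' dps' c3'.
have m0 : 0 < monomial 2^-1 hs a.
  by apply: monomial_gt0 => [|_ /mapP[p pps ->]]; rewrite invr_gt0 ltr0n.
have bound n : trunc_zeta R (entries ps a) n
    <= complex.Re (M / monomial 2^-1 hs a).
  have := hM n [:: a] isT; rewrite big_cons big_nil addr0 sa size_map eqxx.
  rewrite /gen_term normrM (ger0_norm (trunc_zeta_ge0 _ _ _)) (gtr0_norm m0).
  rewrite -ler_pdivlMr // -trunc_zetaC lecE (entries_unzip1 a hsE).
  by case/andP.
have [tz zle] := zeta_star_lim bound; split=> //.
exact: tends_ext (trunc_zetaC _) (tends_complex tz).
Qed.

Lemma kernelC n k : (kernel R n k)%:C%C = kernel C n k.
Proof.
rewrite rmorph_prod; apply: eq_bigr => j _ /=.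
by rewrite rmorphM /= fmorphV rmorphB !rmorph_nat.
Qed.

Lemma tends_kernel k : tends (fun n => kernel C n k) 1.
Proof.
suff h : tends (fun n => kernel R n k) 1.
  exact: tends_ext (kernelC ^~ k) (tends_complex h).
move=> e e0; pose N := Num.Def.archi_bound (k%:R ^+ 2 / e : R).
exists N.+1 => n Nn; have n0 : 0 < n%:R :> R by rewrite ltr0n (leq_trans _ Nn).
rewrite distrC ger0_norm ?subr_ge0 ?kernel_le1 // -(ltr_pM2l n0).
apply: le_lt_trans (kernel_near1 R n k) _; rewrite -ltr_pdivrMr //.
apply: lt_le_trans (archi_boundP _) _; first by rewrite divr_ge0 ?exprn_ge0 // ltW.
by rewrite ler_nat ltnW.
Qed.

Lemma generating_series z0 ps : `|z0| < 1 -> admissible ps -> in_disc ps ->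
  (3 <= next_entry ps)%N ->
  exists2 S, has_sum (fun a => size a == (size ps).+1)
      (fun a => (zeta_star R (entries ps a))%:C%C * monomial z0 ps a) S
    & tends (closed_form z0 ps) S.
Proof.
move=> z1 aps dps c3; have [M hM] := gen_term_bounded z1 aps dps c3.
apply: (tannery hM) => [n a /eqP sa|a /eqP sa|n].
- have [_ zle] := zeta_star_limC aps c3 sa.
  rewrite /gen_term !normrM ler_wpM2r // -trunc_zetaC !ger0_norm ?lecR ?zle //.
    by rewrite (le_trans (trunc_zeta_ge0 _ _ 0) (zle 0%N)).
  exact: trunc_zeta_ge0.
- have [tz _] := zeta_star_limC aps c3 sa.
  rewrite mulrC; apply: tends_ext (tendsZ (monomial z0 ps a) tz) => n.
  by rewrite mulrC.
- have [_] := gen_term_sum n z1 aps dps.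
  by rewrite gen_value_cf ?next_entry_nil.
Qed.

Lemma nested_series z0 ps : `|z0| < 1 -> admissible ps -> in_disc ps ->
  (3 <= next_entry ps)%N ->
  exists2 T, has_sum (dec_pos (size ps).+1) (full_term z0 ps) T
    & tends (fun n => - closed_form z0 ps n) T.
Proof.
move=> z1 aps dps c3; have [M hM] := full_term_bounded z1 aps dps c3.
have le n ks : `|kernel C n (head 0%N ks) * full_term z0 ps ks|
    <= `|full_term z0 ps ks|.
  by rewrite normrM ler_piMl // ger0_norm ?kernel_ge0 ?kernel_le1.
apply: (@tannery R _ _ (fun n ks => kernel C n (head 0%N ks) * full_term z0 ps ks)
  _ _ M) => [n|n ks _|ks _|n].
- by move=> B uB; apply: le_trans (hM B uB); apply: ler_sum => ks _; apply: le.
- exact: le.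
- rewrite -[X in tends _ X]mulr1.
  apply: tends_ext (tendsZ (full_term z0 ps ks) (tends_kernel (head 0%N ks))).
  by move=> n; rewrite mulrC.
- rewrite -sum_full_term opprK.
  have f0 ks : dec_pos (size ps).+1 ks -> ks \notin decs (size ps).+1 n ->
      kernel C n (head 0%N ks) * full_term z0 ps ks = 0.
    move=> dks; case: (leqP (head 0%N ks) n) => [/(dec_pos_decs dks) ->//|nk _].
    by rewrite kernel_gt ?mul0r.
  have := has_sum_finite (decs_uniq (size ps).+1 n) f0.
  congr has_sum; rewrite big_seq_cond [RHS]big_seq; apply: eq_bigl => ks.
  by case: (boolP (ks \in _)) => // /decs_dec_pos ->.
Qed.

End Limit.

Theorem theorem1p4 (R : realType) (d : nat) (c : d.-tuple nat)
    (z : 'I_d.+1 -> R[i])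
    (hd : (1 <= d)%N)
    (hc : forall j : 'I_d, (1 <= tnth c j)%N /\ tnth c j <> 2%N)
    (hc1 : (3 <= nth 0%N c 0)%N)
    (hz : forall j : 'I_d.+1, `|z j| < 1) :
  exists S T : R[i],
    [/\ has_sum predT (lhs_term c z) S,
        has_sum (fun k : d.+1.-tuple nat => weakly_decreasing_pos k)
          (rhs_term c z) T
      & S = - T].
Proof.
pose ps := entry_pairs c z.
have aps : admissible ps.
  rewrite admissible_unzip1 unzip1_entry_pairs; apply/allP => x /tnthP[j ->].
  by have [-> /eqP ->] := hc j.
have dps : in_disc ps by move=> _ /mapP[i _ ->] /=.
have c3 : (3 <= next_entry ps)%N.
  by rewrite next_entry_unzip1 unzip1_entry_pairs -nth0.
have [S hS tS] := generating_series (hz ord0) aps dps c3.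
have [T hT tT] := nested_series (hz ord0) aps dps c3.
have inK : ocancel (insub : seq nat -> option (d.+1.-tuple nat)) val.
  exact: insubK.
have inS (a : seq nat) : size a == (size ps).+1 ->
    (insub a : option (d.+1.-tuple nat)) != None.
  by rewrite size_entry_pairs => sa; case: insubP => //; rewrite sa.
exists S, T; split.
- have Pv (a : d.+1.-tuple nat) : (size (val a) == (size ps).+1) = predT a.
    by rewrite size_entry_pairs size_tuple eqxx.
  have := has_sum_pull valK inK Pv inS hS; apply: has_sum_ext => a _ /=.
  by rewrite lhs_termE.
- have Pv (k : d.+1.-tuple nat) :
      dec_pos (size ps).+1 (val k) = weakly_decreasing_pos k.
    by rewrite /dec_pos size_entry_pairs size_tuple eqxx.
  have inS' k : dec_pos (size ps).+1 k ->
      (insub k : option (d.+1.-tuple nat)) != None.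
    by case/andP => /inS.
  have := has_sum_pull valK inK Pv inS' hT; apply: has_sum_ext => k kP /=.
  by rewrite rhs_termE.
- apply: tends_unique tS _; have := tendsZ (-1) tT; rewrite mulN1r.
  by apply: tends_ext => n; rewrite mulN1r opprK.
Qed.
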